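(* Let $\epsilon\in(0,1)$. There are constants $C=C(\epsilon)>0$ and $C'=C'(\epsilon)>0$ such that the following holds, with no upper bound imposed on the spectral radius (which may grow with $n$). Let $G=(V,E)$ be a graph on $n$ vertices, of maximum degree $\Delta\ge2$, whose adjacency matrix has spectral radius $\rho_G\ge2$, and let $\mu_G$ be the Hard-core model on $G$ with fugacity $\lambda>0$ satisfying $\lambda\le(1-\epsilon)\lambda_c(\rho_G)$. Then the mixing time of the Glauber dynamics on $\mu_G$ is at most $C\,n^{2+C'\sqrt{\Delta/\rho_G}}$.
   Context: All graphs are finite, undirected, simple and connected. The adjacency matrix is the $V\times V$ $0/1$ matrix whose $(u,w)$ entry is $1$ iff $u,w$ are adjacent; its spectral radius is the maximum modulus of its eigenvalues. For real $z>1$, $\lambda_c(z)=\frac{z^z}{(z-1)^{z+1}}$. The Hard-core model with fugacity $\lambda>0$ is the distribution on independent sets $\sigma$ of $G$ with $\mu_G(\sigma)\propto\lambda^{|\sigma|}$; independent sets are encoded as elements of $\{\pm1\}^V$, where $+1$ means the vertex is in the set. Glauber dynamics for a distribution $\mu$ on $\{\pm1\}^V$: the discrete-time Markov chain $(X_t)_{t\ge0}$ on the support of $\mu$ which, given $X_t$, picks a vertex $v$ uniformly at random, sets $X_{t+1}(w)=X_t(w)$ for all $w\ne v$, and samples $X_{t+1}(v)$ from the marginal of $\mu$ at $v$ conditional on the configuration $X_{t+1}$ on the neighbours of $v$. With transition matrix $P$ and stationary distribution $\mu$, the mixing time is $T_{\rm mix}=\min\{t\ge0:\ \|P^t(\sigma,\cdot)-\mu\|_{tv}\le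 1/4\ \text{for all }\sigma\text{ in the support of }\mu\}$, where $\|\nu-\hat\nu\|_{tv}=\frac12\sum_x|\nu(x)-\hat\nu(x)|$. *)

(* Defs.v *)
From HB Require Import structures.
From mathcomp Require Import all_boot all_order all_algebra.
From mathcomp Require Import all_classical all_reals all_analysis.
From mathcomp Require Import complex.

Set Implicit Arguments.
Unset Strict Implicit.
Unset Printing Implicit Defensive.

Import Order.TTheory GRing.Theory Num.Theory.
Local Open Scope ring_scope.

(* A graph is a symmetric irreflexive relation [e] on a finite vertex type. *)

Definition max_degree (V : finType) (e : rel V) : nat :=
  \max_(v : V) #|[pred w | e v w]|.

Definition adjacency (R : realType) (V : finType) (e : rel V) : 'M[R]_#|V| :=
  \matrix_(i, j) (e (enum_val i) (enum_val j))%:R.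

(* The eigenvalues are the complex ones. They form a finite set, nonempty when
   n > 0, so the supremum is then a maximum. *)
Definition spectral_radius (R : realType) (n : nat) (A : 'M[R]_n) : R :=
  sup [set ComplexField.Normc.normc a
      | a in [set a : R[i] | eigenvalue (map_mx (real_complex R) A) a]]%classic.

Definition lambda_c (R : realType) (z : R) : R :=
  z `^ z / (z - 1) `^ (z + 1).

(* Elements of {-1, +1}^V; the spin +1 is [true]. *)
Definition config (V : finType) := {ffun V -> bool}.

Definition independent (V : finType) (e : rel V) (s : config V) : bool :=
  [forall u, forall w, e u w ==> ~~ (s u && s w)].

Definition hc_weight (R : realType) (V : finType) (e : rel V) (lambda : R)
    (s : config V) : R :=
  if independent e s then lambda ^+ #|[pred v | s v]| else 0.

Definition hard_core (R : realType) (V : finType) (e : rel V) (lambda : R)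
    (s : config V) : R :=
  hc_weight e lambda s / \sum_(t : config V) hc_weight e lambda t.

Definition agree_on (V : finType) (A : pred V) (s t : config V) : bool :=
  [forall w, A w ==> (s w == t w)].

(* Marginal probability under [mu] of spin [b] at [v], conditional on the
   configuration being equal to [s] on the neighbours of [v]. *)
Definition cond_marginal (R : realType) (V : finType) (e : rel V)
    (mu : config V -> R) (v : V) (s : config V) (b : bool) : R :=
  (\sum_(t : config V | agree_on (e v) t s && (t v == b)) mu t)
  / \sum_(t : config V | agree_on (e v) t s) mu t.

Definition glauber (R : realType) (V : finType) (e : rel V)
    (mu : config V -> R) (s t : config V) : R :=
  #|V|%:R^-1 *
  \sum_(v : V | agree_on (predC1 v) t s) cond_marginal e mu v t (t v).

(* The state space of the chain is the support of [mu]: intermediate states and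
   the total variation distance below range over it. *)
Fixpoint kernel_pow (R : realType) (X : finType) (mu : X -> R)
    (P : X -> X -> R) (k : nat) (x y : X) : R :=
  if k is k'.+1
  then \sum_(z : X | mu z != 0) kernel_pow mu P k' x z * P z y
  else (x == y)%:R.

Definition tv_dist (R : realType) (X : finType) (mu nu nu' : X -> R) : R :=
  2^-1 * \sum_(x : X | mu x != 0) `|nu x - nu' x|.

(* The minimum in the definition of the mixing time, as an extended real, with
   value +oo if the chain never gets within distance 1/4 of [mu]. *)
Definition mixing_time (R : realType) (X : finType) (mu : X -> R)
    (P : X -> X -> R) : \bar R :=
  ereal_inf [set (k%:R : R)%:E | k in [set k : nat | forall x : X, mu x != 0 ->
    tv_dist mu (kernel_pow mu P k x) mu <= 4^-1]]%classic.

(* Main.v *)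
From mathcomp Require Import all_boot all_order all_algebra.
From mathcomp Require Import all_classical all_reals all_analysis.
From mathcomp Require Import complex ring lra.
Require Import Defs.

(** The proof goes from a bound on influences, through a Poincare inequality, to
    the mixing time.  Conditioning the hard-core model leaves a hard-core model
    on a smaller set [S] of vertices, so all sets [S] are treated at once.

    Influences.  Weitz's recursion ([influence_recursion]) expresses the
    influences of a vertex [v] through those of its neighbours in smaller
    vertex sets.  Measured with the potential [Num.sqrt (occ S v)] and with a
    suitable power of the Perron vector of the adjacency matrix as weights, one
    step of the recursion is a strict contraction as soon as
    [lam <= (1 - eps) * lambda_c rho] ([contraction]); the sum over the
    neighbours is absorbed by the eigenvalue equation, which is how the
    spectral radius replaces the maximum degree.  The degree enters only at the
    root, where Hoelder's inequality costs at most
    [Num.sqrt (max_degree e / rho)].  So all weighted row sums of the influence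
    matrices are at most [1 + eta], with [eta] of that order
    ([total_influence]).

    Poincare inequality.  An influence is a covariance divided by a variance,
    and covariances are symmetric, so Schur's test turns the row-sum bound into
    spectral independence ([spectral_independence]).  Revealing the vertices in
    random order then compares the variance of a function with the Dirichlet
    form of the dynamics, at the price of a factor [n `^ (20 * eta)]
    ([poincare]).

    Mixing.  An update is a conditional expectation, so a Poincare inequality
    makes the variance decay geometrically ([step_contracts]).  The total
    variation distance is half the difference of the two means of a test
    function with values in [[-1, 1]], and this difference is bounded through
    the variance and the probability of the starting state
    ([tv_of_contraction]).  That probability is at least [expR (- O(n ^ 2))]
    unless [lam] is below [1 / (16 * n)]; for such [lam] the expected number of
    occupied vertices alone forces mixing ([tv_of_small_fugacity]).  All
    polynomial losses fit into the exponent because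
    [Num.sqrt (max_degree e / rho) >= 1]. *)

Set Implicit Arguments.
Unset Strict Implicit.
Unset Printing Implicit Defensive.

Import Order.TTheory GRing.Theory Num.Theory.
Import numFieldNormedType.Exports.
Local Open Scope ring_scope.

(** * Loss at one level of the induction on the number of vertices *)

Section Growth.
Variable R : realType.
Implicit Types (x B eta : R).

Lemma powR_growth j eta : (0 < j)%N -> 0 <= eta ->
  expR (10 * eta / j%:R) * j%:R `^ (20 * eta) <= j.+1%:R `^ (20 * eta) :> R.
Proof.
move=> j0 eta0; have J0 : 0 < j%:R :> R by rewrite ltr0n.
have J1 : 0 < j.+1%:R :> R by rewrite ltr0n.
rewrite /powR !gt_eqF // -expRD ler_expR.
suff : j%:R^-1 / 2 <= ln j.+1%:R - ln j%:R :> R.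
  move=> H; have := ler_wpM2l (mulr_ge0 (ler0n R 20) eta0) H; lra.
rewrite -ln_div // -[_ / _ in leRHS]invrK lnV ?posrE ?invr_gt0 ?divr_gt0 //.
rewrite invf_div lerNr.
have -> : j%:R / j.+1%:R = 1 + (- j.+1%:R^-1) :> R.
  by rewrite -natr1; field; rewrite natr1 gt_eqF.
apply: (le_trans (le_ln1Dx _)).
  by rewrite ltrN2 invf_lt1 // ltr1n.
rewrite lerN2 -invfM lef_pV2 ?posrE ?mulr_gt0 //.
by rewrite -natrM ler_nat muln2 -addnn -addn1 leq_add2l.
Qed.

(** If [eta <= j / 2] the first bound on [x] applies, and otherwise the second
    does, as then the exponential is at least [expR 5 >= 10]. *)
Lemma growth_step j eta x B : (0 < j)%N -> 0 <= eta -> 0 <= B ->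
  (j%:R - eta) * x <= j%:R * B -> x <= 10 * B ->
  x <= expR (10 * eta / j%:R) * B.
Proof.
move=> j0 eta0 B0 H1 H2; have J0 : 0 < j%:R :> R by rewrite ltr0n.
have [x0|x0] := lerP x 0.
  by apply: (le_trans x0); rewrite mulr_ge0 ?expR_ge0.
set t := eta / j%:R; have t0 : 0 <= t by rewrite divr_ge0 ?(ltW J0).
rewrite -mulrA -/t; have [th|th] := lerP t (1 / 2).
  apply: (@le_trans _ _ ((1 + 10 * t) * B)); last first.
    by rewrite ler_wpM2r // expR_ge1Dx.
  have H3 : (1 - t) * x <= B.
    have -> : (1 - t) * x = (j%:R - eta) * x / j%:R by rewrite /t; field; rewrite gt_eqF.
    by rewrite ler_pdivrMr // [leRHS]mulrC.
  apply: (@le_trans _ _ ((1 + 10 * t) * ((1 - t) * x))); last first.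
    by rewrite ler_wpM2l // addr_ge0 // mulr_ge0.
  rewrite mulrA ler_peMl ?(ltW x0) //; nra.
apply: (le_trans H2); rewrite ler_wpM2r //.
(* here [t > 1 / 2], and [expR 5 >= 2 ^ 5 >= 10] *)
apply: (@le_trans _ _ (expR (5%:R * 1))); last first.
  by rewrite ler_expR; lra.
rewrite expRM_natl; apply: (@le_trans _ _ (2 ^+ 5)).
  by rewrite -natrX ler_nat.
rewrite lerXn2r ?nnegrE ?expR_ge0 //.
by have := expR_ge1Dx (1 : R); lra.
Qed.
End Growth.

(** * Contraction below the uniqueness threshold *)

Section Contraction.
Variable R : realType.

Lemma min_of_derive_sign (psi dpsi : R -> R) (y0 : R) : 0 < y0 ->
  (forall y : R, 0 < y -> is_derive y 1 psi (dpsi y)) ->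
  (forall y, 0 < y -> y < y0 -> dpsi y <= 0) ->
  (forall y, y0 < y -> 0 <= dpsi y) ->
  forall y, 0 < y -> psi y0 <= psi y.
Proof.
move=> y00 D neg pos y yp.
have cont u v : 0 < u -> {within `[u, v], continuous psi}%classic.
  move=> u0; apply: derivable_within_continuous => x; rewrite in_itv /= => /andP[ux _].
  by have [] := D x (lt_le_trans u0 ux).
have [yy|yy|->] := ltgtP y y0; last by [].
- have [x|c] := @MVT _ psi dpsi _ _ yy _ (cont y y0 yp).
    by rewrite in_itv /= => /andP[yx _]; apply: D; exact: lt_trans yx.
  rewrite in_itv /= => /andP[yc cy0] E.
  by rewrite -subr_le0 E mulr_le0_ge0 ?subr_ge0 ?(ltW yy) // neg // (lt_trans yp).
- have [x|c] := @MVT _ psi dpsi _ _ yy _ (cont y0 y y00).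
    by rewrite in_itv /= => /andP[yx _]; apply: D; exact: lt_trans yx.
  rewrite in_itv /= => /andP[yc cy0] E.
  by rewrite -subr_ge0 E mulr_ge0 ?subr_ge0 ?(ltW yy) // pos.
Qed.

(** The exponential lies above its tangent at the weighted mean of [ln x] and
    [ln y]. *)
Lemma young (x y a : R) : 0 < x -> 0 < y -> 0 <= a <= 1 ->
  x `^ a * y `^ (1 - a) <= a * x + (1 - a) * y.
Proof.
move=> x0 y0 /andP[a0 a1]; rewrite /powR !gt_eqF // -expRD.
set z := _ + _.
have Hx : expR z * (1 + (ln x - z)) <= x.
  apply: (@le_trans _ _ (expR z * expR (ln x - z))).
    by rewrite ler_wpM2l ?expR_ge0 // expR_ge1Dx.
  by rewrite -expRD addrC subrK lnK ?posrE.
have Hy : expR z * (1 + (ln y - z)) <= y.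
  apply: (@le_trans _ _ (expR z * expR (ln y - z))).
    by rewrite ler_wpM2l ?expR_ge0 // expR_ge1Dx.
  by rewrite -expRD addrC subrK lnK ?posrE.
have := lerD (ler_wpM2l a0 Hx) (ler_wpM2l (_ : 0 <= 1 - a) Hy).
rewrite subr_ge0 => /(_ a1); apply: le_trans.
by rewrite le_eqVlt; apply/orP; left; apply/eqP; rewrite /z; ring.
Qed.

Lemma hoelder_sum (T : finType) (A : {set T}) (x y : T -> R) (a : R) :
  0 <= a <= 1 -> (forall u, u \in A -> 0 < x u) -> (forall u, u \in A -> 0 < y u) ->
  \sum_(u in A) x u `^ a * y u `^ (1 - a)
    <= (\sum_(u in A) x u) `^ a * (\sum_(u in A) y u) `^ (1 - a).
Proof.
move=> a01 x0 y0.
have [->|[v vA]] := set_0Vmem A.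
  by rewrite !big_set0 mulr_ge0 ?powR_ge0.
set X := \sum_(u in A) x u; set Y := \sum_(u in A) y u.
have X0 : 0 < X.
  rewrite /X (bigD1 v) //= ltr_pwDl ?x0 //; apply: sumr_ge0 => u /andP[uA _].
  by rewrite ltW ?x0.
have Y0 : 0 < Y.
  rewrite /Y (bigD1 v) //= ltr_pwDl ?y0 //; apply: sumr_ge0 => u /andP[uA _].
  by rewrite ltW ?y0.
have E1 : \sum_(u in A) (a * (x u / X) + (1 - a) * (y u / Y)) = 1.
  rewrite big_split /= -!mulr_sumr -!mulr_suml -/X -/Y !divff ?gt_eqF //.
  by rewrite !mulr1 addrC subrK.
rewrite -[leRHS]mul1r -[X in _ <= X * _]E1 mulr_suml; apply: ler_sum => u uA.
rewrite -{1}[x u](@divfK _ X) ?gt_eqF // -{1}[y u](@divfK _ Y) ?gt_eqF //.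
have xX : 0 < x u / X by rewrite divr_gt0 ?x0.
have yY : 0 < y u / Y by rewrite divr_gt0 ?y0.
rewrite powRM ?(ltW xX) ?(ltW X0) // [(_ / Y * Y) `^ _]powRM ?(ltW yY) ?(ltW Y0) //.
by rewrite mulrACA ler_wpM2r ?mulr_ge0 ?powR_ge0 // young.
Qed.

Variables (k eps : R).
Hypotheses (k2 : 2 <= k) (eps0 : 0 < eps) (eps1 : eps < 1).

(** At the critical fugacity of the tree in which every vertex has [k] children,
    the fixed point of the recursion has occupation probability [1 / k], and
    [crit] is [- ln (1 - 1 / k)].  Hoelder's inequality is used with exponents
    [2 * expo] and its conjugate, and [hexp] is [1 / (2 * expo)].  This value of
    [expo] makes [powR_occ_le] and [critical_occ_le] sharp at that fixed point. *)
Definition crit : R := ln (k / (k - 1)).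
Definition expo : R := ((k - 1) * crit)^-1.
Definition hexp : R := (k - 1) * crit / 2.

Let k0 : 0 < k. Proof. by have := k2; lra. Qed.
Let k1 : 0 < k - 1. Proof. by have := k2; lra. Qed.

Lemma expR_crit : expR crit = k / (k - 1).
Proof. by rewrite lnK // posrE divr_gt0. Qed.

Lemma crit_gt0 : 0 < crit.
Proof. by rewrite ln_gt0 // ltr_pdivlMr //; lra. Qed.

Lemma crit_le : crit <= (k - 1)^-1.
Proof.
rewrite /crit; have -> : k / (k - 1) = 1 + (k - 1)^-1 by field; rewrite gt_eqF.
by apply: le_ln1Dx; apply: (@lt_trans _ _ 0); rewrite ?invr_gt0 ?ltrN10.
Qed.

Lemma k1crit : 0 < (k - 1) * crit <= 1.
Proof.
rewrite mulr_gt0 ?crit_gt0 //=; have := crit_le.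
by rewrite -[_^-1]mul1r ler_pdivlMr // mulrC.
Qed.

Lemma kcrit_le2 : k * crit <= 2.
Proof.
have /andP[_ h] := k1crit.
have : 0 <= (k - 2) * crit by rewrite mulr_ge0 ?subr_ge0 // ltW ?crit_gt0.
by lra.
Qed.

Lemma expo_gt0 : 0 < expo.
Proof. by rewrite invr_gt0; case/andP: k1crit. Qed.

Lemma hexp_bounds : 0 < hexp <= 1 / 2.
Proof. by have := k1crit; rewrite /hexp => /andP[? ?]; apply/andP; split; lra. Qed.

Lemma expo_hexp : expo * hexp = 1 / 2.
Proof. by rewrite /expo /hexp; case/andP: k1crit => ? _; field; rewrite !gt_eqF ?crit_gt0. Qed.

(** With [y = - ln (1 - p)], the function [ln y - expo * ln (1 - expR (- y))]
    decreases up to [crit] and increases afterwards: by convexity of the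
    exponential, [expR y - 1 - expo * y] changes sign only there. *)
Lemma powR_occ_le (p : R) : 0 < p < 1 ->
  expo * ln (k * p) <= ln (- ln (1 - p) / crit).
Proof.
move=> /andP[p0 p1]; set y := - ln (1 - p).
have q0 : 0 < 1 - p by rewrite subr_gt0.
have y0 : 0 < y by rewrite /y oppr_gt0 ln_lt0 // q0 /= ltrBlDr ltrDl.
have Ey : expR y = (1 - p)^-1 by rewrite /y expRN lnK ?posrE.
pose psi z : R := ln z - expo * (ln (expR z - 1) - z).
pose dpsi z : R := z^-1 - expo * (expR z * (expR z - 1)^-1 - 1).
have e1 (z : R) : 0 < z -> 0 < expR z - 1 by move=> z0; rewrite subr_gt0 expR_gt1.
have D (z : R) : 0 < z -> is_derive z 1 psi (dpsi z).
  move=> z0.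
  have D1 := is_derive1_ln z0.
  have D2 := is_derive1_ln (e1 z z0).
  have D3 : is_derive z 1 (fun x : R => expR x - 1) (expR z).
    by apply: is_derive_eq; rewrite subr0.
  have D4 : is_derive z 1 (fun x : R => ln (expR x - 1)) (expR z * (expR z - 1)^-1).
    by rewrite mulrC; exact: (@is_derive1_comp _ (@ln R) (fun x => expR x - 1) z _ _ D2 D3).
  by rewrite /psi /dpsi; apply: is_derive_eq.
have dE (z : R) : 0 < z -> dpsi z = (expR z - 1 - expo * z) / (z * (expR z - 1)).
  by move=> z0; rewrite /dpsi; field; rewrite !gt_eqF ?e1.
have cE : expR crit - 1 = expo * crit.
  rewrite expR_crit /expo; have := crit_gt0 => c0.
  by field; rewrite !gt_eqF.
have H : psi crit <= psi y.
  apply: (min_of_derive_sign crit_gt0 D) => // z z0.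
    move=> zc; rewrite dE // ler_pdivrMr ?mul0r ?mulr_gt0 ?e1 //.
    set t := z / crit; have t0 : 0 < t by rewrite divr_gt0 ?crit_gt0.
    have t1 : t <= 1 by rewrite ler_pdivrMr ?crit_gt0 // mul1r ltW.
    have zE : z = t * crit by rewrite /t divfK // gt_eqF ?crit_gt0.
    have t01 : 0 <= t <= 1 by rewrite (ltW t0).
    have := young (expR_gt0 crit) ltr01 t01.
    rewrite powR1 mulr1 mulr1 /powR gt_eqF ?expR_gt0 // expRK -zE.
    have : expo * z = t * (expo * crit) by rewrite zE; ring.
    by rewrite -cE => -> ?; lra.
  have zp : 0 < z by apply: lt_trans z0; exact: crit_gt0.
  rewrite dE // divr_ge0 ?mulr_ge0 ?(ltW zp) ?(ltW (e1 z zp)) //.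
  set t := crit / z; have t0 : 0 < t by rewrite divr_gt0 ?crit_gt0.
  have t1 : t <= 1 by rewrite ler_pdivrMr // mul1r ltW.
  have zE : crit = t * z by rewrite /t divfK // gt_eqF.
  have t01 : 0 <= t <= 1 by rewrite (ltW t0).
  have := young (expR_gt0 z) ltr01 t01.
  rewrite powR1 mulr1 mulr1 /powR gt_eqF ?expR_gt0 // expRK -zE => Yg.
  have E : t * (expo * z) = expo * crit by rewrite zE; ring.
  have := cE; rewrite -E => E'.
  have : 0 <= t * (expR z - 1 - expo * z) by lra.
  by rewrite pmulr_rge0.
have psiE : psi crit = ln crit + expo * ln k.
  rewrite /psi expR_crit; have -> : k / (k - 1) - 1 = (k - 1)^-1 by field; rewrite gt_eqF.
  by rewrite lnV ?posrE // /crit ln_div ?posrE //; ring.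
have psyE : psi y = ln y - expo * ln p.
  rewrite /psi Ey; have -> : (1 - p)^-1 - 1 = p / (1 - p) by field; rewrite gt_eqF.
  by rewrite ln_div ?posrE // /y; ring.
move: H; rewrite psiE psyE ln_div ?posrE ?crit_gt0 // lnM ?posrE // mulrDr; lra.
Qed.

(** At the critical fugacity, children with [\sum - ln (1 - p u) = Y] give their
    parent the odds [expR (k * crit - Y) / (k - 1)].  Both logarithms are concave
    in [Y], and their tangents at [Y = k * crit] cancel. *)
Lemma critical_occ_le (Y : R) : 0 < Y ->
  expo * ln (k / (1 + (k - 1) * expR (Y - k * crit))) + ln (Y / (k * crit)) <= 0.
Proof.
move=> Y0; set tau := Y - k * crit; set c := 1 - k^-1.
have kc0 : 0 < k * crit by rewrite mulr_gt0 ?crit_gt0.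
have H1 : ln (Y / (k * crit)) <= tau / (k * crit).
  have -> : Y / (k * crit) = 1 + tau / (k * crit).
    by rewrite /tau; field; rewrite !gt_eqF ?crit_gt0.
  apply: le_ln1Dx; rewrite /tau mulrBl divff ?gt_eqF // ltrBrDl subrr.
  by rewrite divr_gt0.
have c01 : 0 <= c <= 1.
  have : 0 < k^-1 by rewrite invr_gt0.
  have : k^-1 <= 2^-1 by rewrite lef_pV2 ?posrE.
  by rewrite /c => ? ?; apply/andP; split; lra.
have D0 : 0 < 1 + (k - 1) * expR tau by rewrite addr_gt0 // mulr_gt0 ?expR_gt0.
have H2 : ln (k / (1 + (k - 1) * expR tau)) <= - (c * tau).
  rewrite -[k in k / _]invrK -invfM lnV ?posrE ?mulr_gt0 ?invr_gt0 // lerN2.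
  rewrite -ler_expR lnK ?posrE ?mulr_gt0 ?invr_gt0 //.
  have := young (expR_gt0 tau) ltr01 c01.
  rewrite powR1 mulr1 mulr1 /powR gt_eqF ?expR_gt0 // expRK => H.
  apply: (le_trans H); rewrite le_eqVlt; apply/orP; left; apply/eqP.
  by rewrite /c; field; rewrite gt_eqF.
have H3 := ler_wpM2l (ltW expo_gt0) H2.
have E : expo * - (c * tau) = - (tau / (k * crit)).
  by rewrite /expo /c; field; rewrite !gt_eqF ?crit_gt0.
by lra.
Qed.

Lemma lambda_cE : lambda_c k = expR (k * crit) / (k - 1).
Proof.
rewrite /lambda_c /powR !gt_eqF // -expRN -expRD -{2}[k - 1]lnK ?posrE // -expRN -expRD.
by congr expR; rewrite /crit ln_div ?posrE //; ring.
Qed.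

Lemma expR2_le9 : expR 2 <= 9 :> R.
Proof.
have H : expR (8%:R^-1) <= 8 / 7 :> R.
  have := expR_ge1Dx (- (8%:R^-1 : R)); rewrite expRN => H.
  rewrite -[leLHS]invrK -[leRHS]invrK lef_pV2 ?posrE ?invr_gt0 ?expR_gt0 ?divr_gt0 //.
  by apply: le_trans H; rewrite invf_div; lra.
(* four squarings of [expR (1 / 8) <= 8 / 7] *)
have -> : (2 : R) = 16%:R * 8%:R^-1 by field.
rewrite expRM_natl; set x := expR _ in H *; have x0 : 0 <= x by exact: expR_ge0.
have sq (t c d : R) : 0 <= t -> t <= c -> c ^+ 2 <= d -> t ^+ 2 <= d.
  move=> t0 tc; apply: le_trans; rewrite lerXn2r ?nnegrE //; exact: le_trans tc.
have x2 : x ^+ 2 <= 1307 / 1000 by apply: (sq _ _ _ x0 H); rewrite expr2; lra.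
have x4 : x ^+ 2 ^+ 2 <= 171 / 100.
  by apply: (sq _ _ _ _ x2); rewrite ?sqr_ge0 // expr2; lra.
have x8 : x ^+ 2 ^+ 2 ^+ 2 <= 294 / 100.
  by apply: (sq _ _ _ _ x4); rewrite ?sqr_ge0 // expr2; lra.
have : x ^+ 2 ^+ 2 ^+ 2 ^+ 2 <= 9.
  by apply: (sq _ _ _ _ x8); rewrite ?sqr_ge0 // expr2; lra.
by rewrite -!exprM.
Qed.

Lemma lambda_c_gt0 : 0 < lambda_c k.
Proof. by rewrite lambda_cE divr_gt0 ?expR_gt0. Qed.

Lemma lambda_c_le : lambda_c k <= 9 / (k - 1).
Proof.
rewrite lambda_cE ler_pM2r ?invr_gt0 //; apply: le_trans expR2_le9.
by rewrite ler_expR kcrit_le2.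
Qed.

Lemma lambda_c_le9 : lambda_c k <= 9.
Proof.
apply: (le_trans lambda_c_le); rewrite ler_pdivrMr //.
by have := k2; lra.
Qed.

Lemma lambda_c_le18 : lambda_c k <= 18 / k.
Proof.
apply: (le_trans lambda_c_le); rewrite ler_pdivrMr // mulrAC ler_pdivlMr //.
by have := k2; lra.
Qed.

(** The critical odds are at most [9], so lowering the fugacity by the factor
    [1 - eps] lowers the occupation probability by a constant factor too. *)
Lemma occ_slack (lam Y : R) : 0 < lam -> lam <= (1 - eps) * lambda_c k -> 0 <= Y ->
  lam * expR (- Y) / (1 + lam * expR (- Y))
    <= (1 - eps / 10) / (1 + (k - 1) * expR (Y - k * crit)).
Proof.
move=> l0 ll Y0; set x := lam * expR (- Y); set u := lambda_c k * expR (- Y).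
have e0 := eps0; have e1 := eps1.
have x0 : 0 < x by rewrite mulr_gt0 ?expR_gt0.
have u0 : 0 < u by rewrite mulr_gt0 ?expR_gt0 ?lambda_c_gt0.
have xu : x <= (1 - eps) * u by rewrite mulrA ler_wpM2r ?expR_ge0.
have u9 : u <= 9.
  apply: (le_trans _ lambda_c_le9); rewrite ler_piMr ?(ltW lambda_c_gt0) //.
  by rewrite expRN invf_le1 ?expR_gt0 // -[1]expR0 ler_expR.
have -> : (k - 1) * expR (Y - k * crit) = u^-1.
  by rewrite /u lambda_cE expRD !expRN; field; rewrite !gt_eqF ?expR_gt0.
have -> : (1 - eps / 10) / (1 + u^-1) = (1 - eps / 10) * u / (1 + u).
  by field; rewrite !gt_eqF // addr_gt0.
rewrite ler_pdivrMr ?addr_gt0 // mulrAC ler_pdivlMr ?addr_gt0 //.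
have h : x * (1 + eps / 10 * u) <= (1 - eps) * u * (1 + eps / 10 * u).
  by rewrite ler_wpM2r // addr_ge0 // mulr_ge0 ?(ltW u0) //; lra.
have h2 : 0 <= u * (eps / 10 * (9 - (1 - eps) * u)).
  rewrite mulr_ge0 ?(ltW u0) // mulr_ge0 //; first by lra.
  by rewrite subr_ge0; nra.
by lra.
Qed.

Lemma sum_sqrt_le (T : finType) (A : {set T}) (p F : T -> R) :
  (forall u, u \in A -> 0 < p u) -> (forall u, 0 < F u) ->
  \sum_(u in A) Num.sqrt (p u) * F u `^ (1 - hexp)
    <= (\sum_(u in A) p u `^ expo) `^ hexp * (\sum_(u in A) F u) `^ (1 - hexp).
Proof.
move=> p0 F0; have /andP[a0 a1] := hexp_bounds.
apply: le_trans (hoelder_sum _ _ _) => //; last 2 first.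
- by apply/andP; split; lra.
- by move=> u uA; rewrite powR_gt0 ?p0.
apply: ler_sum => u uA; rewrite -powRrM expo_hexp.
by rewrite -powR12_sqrt ?(ltW (p0 u uA)) // mul1r.
Qed.

(** By Hoelder's inequality the sum splits into [\sum p u `^ expo] and
    [\sum F u].  The former is at most a multiple of [- ln (\prod (1 - p u))],
    and this product also determines the odds at the parent, so one inequality
    in a single variable remains. *)
Lemma contraction (T : finType) (A : {set T}) (p F : T -> R) (Fv lam : R) :
  (forall u, u \in A -> 0 < p u < 1) -> (forall u, 0 < F u) -> 0 < Fv ->
  \sum_(u in A) F u <= k * Fv ->
  0 < lam -> lam <= (1 - eps) * lambda_c k ->
  let odds := lam * \prod_(u in A) (1 - p u) in
  Num.sqrt (odds / (1 + odds)) * \sum_(u in A) Num.sqrt (p u) * F u `^ (1 - hexp)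
    <= Num.sqrt (1 - eps / 10) * Fv `^ (1 - hexp).
Proof.
move=> p01 F0 Fv0 sumF l0 ll /=; set odds := lam * _.
have [A0|[v vA]] := set_0Vmem A.
  by rewrite A0 big_set0 mulr0 mulr_ge0 ?sqrtr_ge0 ?powR_ge0.
have e0 := eps0; have e1 := eps1; have c0 := crit_gt0; have r0 := expo_gt0.
have /andP[a0 a1] := hexp_bounds.
have b0 : 0 <= 1 - hexp by lra.
set y := fun u => - ln (1 - p u); set Y := \sum_(u in A) y u.
have y0 u : u \in A -> 0 < y u.
  move=> /p01/andP[q0 q1]; rewrite /y oppr_gt0 ln_lt0 // subr_gt0 q1 /=.
  by rewrite ltrBlDr ltrDl.
have Y0 : 0 < Y.
  rewrite /Y (bigD1 v) //= ltr_pwDl ?y0 //; apply: sumr_ge0 => u /andP[uA _].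
  by rewrite ltW ?y0.
have prodE : \prod_(u in A) (1 - p u) = expR (- Y).
  rewrite /Y -sumrN expR_sum; apply: eq_bigr => u /p01/andP[_ q1].
  by rewrite opprK lnK // posrE subr_gt0.
set P := (1 + (k - 1) * expR (Y - k * crit))^-1.
have P0 : 0 < P by rewrite invr_gt0 addr_gt0 // mulr_gt0 ?expR_gt0.
have step1 : Num.sqrt (odds / (1 + odds)) <= Num.sqrt (1 - eps / 10) * Num.sqrt P.
  rewrite -sqrtrM; last by lra.
  by rewrite ler_wsqrtr // /odds prodE occ_slack // ltW.
have p0 u : u \in A -> 0 < p u by move=> /p01/andP[].
have step2 := sum_sqrt_le p0 F0.
have step3 : \sum_(u in A) p u `^ expo <= Y / (crit * k `^ expo).
  rewrite /Y mulr_suml; apply: ler_sum => u uA.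
  rewrite invfM mulrA ler_pdivlMr ?powR_gt0 // -powRM ?(ltW (p0 u uA)) ?(ltW k0) //.
  have := powR_occ_le (p01 u uA); rewrite -/(y u) -ler_expR => H.
  rewrite /powR gt_eqF ?mulr_gt0 ?p0 // [p u * k]mulrC.
  by apply: (le_trans H); rewrite lnK // posrE divr_gt0 ?y0.
have X0 : 0 <= \sum_(u in A) p u `^ expo by apply: sumr_ge0 => u _; exact: powR_ge0.
have S0 : 0 <= \sum_(u in A) F u by apply: sumr_ge0 => u _; exact: ltW.
have step4 : Num.sqrt P * ((Y / (crit * k `^ expo)) `^ hexp * k `^ (1 - hexp)) <= 1.
  have D0 : 0 < Y / (crit * k `^ expo) by rewrite divr_gt0 // mulr_gt0 ?powR_gt0.
  have L := critical_occ_le Y0; have r0' : 0 < k * crit by rewrite mulr_gt0.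
  have h2 : 2^-1 = expo * hexp by rewrite expo_hexp; lra.
  move: D0; set W := Y / _ => D0.
  rewrite -powR12_sqrt ?(ltW P0) // /powR !gt_eqF // -!expRD -[leRHS]expR0 ler_expR.
  rewrite /W h2 ln_div ?posrE ?mulr_gt0 ?powR_gt0 // lnM ?posrE ?powR_gt0 // ln_powR.
  move: L; rewrite -/P [ln (k * P)]lnM ?posrE // [ln (Y / _)]ln_div ?posrE //.
  rewrite [ln (k * crit)]lnM ?posrE // => L.
  have := ler_wpM2l (ltW a0) L; rewrite mulr0; have := expo_hexp.
  move=> E H; have Ek : expo * hexp * ln k = ln k / 2 by rewrite E; lra.
  by apply: le_trans H; lra.
apply: (le_trans (ler_pM (sqrtr_ge0 _) _ step1 step2)).
  by apply: sumr_ge0 => u _; rewrite mulr_ge0 ?sqrtr_ge0 ?powR_ge0.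
apply: (@le_trans _ _ (Num.sqrt (1 - eps / 10) * Num.sqrt P *
   ((Y / (crit * k `^ expo)) `^ hexp * (k * Fv) `^ (1 - hexp)))).
  rewrite ler_wpM2l ?mulr_ge0 ?sqrtr_ge0 // ler_pM ?powR_ge0 //.
    by rewrite ge0_ler_powR ?nnegrE ?(ltW a0) // (le_trans X0).
  by rewrite ge0_ler_powR ?nnegrE // mulr_ge0 // ltW.
rewrite powRM ?(ltW k0) ?(ltW Fv0) // -[leRHS]mulr1 -!mulrA ler_wpM2l ?sqrtr_ge0 //.
have -> : forall x y z : R, Num.sqrt P * (x * (y * z)) = z * (Num.sqrt P * (x * y)).
  by move=> ? ? ?; ring.
by rewrite ler_wpM2l ?powR_ge0.
Qed.

End Contraction.

(** * A positive vector attached to the spectral radius *)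

Section SymmetricMatrix.
Variables (R : realType) (n : nat) (A : 'M[R]_n).
Hypotheses (A_sym : forall i j, A i j = A j i) (A_ge0 : forall i j, 0 <= A i j).
Implicit Types (x : 'rV[R]_n).

Let quad x : R := \sum_i \sum_j x 0 i * A i j * x 0 j.
Let sqn x : R := \sum_i x 0 i ^+ 2.

Let add_cont : continuous (fun p : R * R => p.1 + p.2).
Proof. exact: add_continuous. Qed.

Lemma quad_continuous : continuous quad.
Proof.
apply: (continuous_big add_cont) => i _; apply: (continuous_big add_cont) => j _ x.
apply: (@continuousM _ _ (fun x : 'rV[R]_n => x 0 i * A i j) (fun x : 'rV[R]_n => x 0 j)).
  apply: (@continuousM _ _ (fun x : 'rV[R]_n => x 0 i) (fun=> A i j)).
    exact: coord_continuous.
  exact: cst_continuous.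
exact: coord_continuous.
Qed.

Lemma sqn_continuous : continuous sqn.
Proof.
apply: (continuous_big add_cont) => i _ x.
apply: (@continuousM _ _ (fun x : 'rV[R]_n => x 0 i) (fun x : 'rV[R]_n => x 0 i));
  exact: coord_continuous.
Qed.

Lemma sphere_compact : compact [set x | sqn x = 1]%classic.
Proof.
apply: (@subclosed_compact _ _
  [set x : 'rV[R]_n | forall i, `[(-1 : R), 1]%classic (x 0 i)]%classic).
- apply: (@preimage_closed _ _ sqn [set 1 : R]%classic); last exact: closed_eq.
  by move=> x _; exact: sqn_continuous.
- by apply: (@rV_compact _ _ (fun=> `[(-1 : R), 1]%classic)) => _; exact: segment_compact.
move=> x /= sx i; rewrite in_itv /= -ler_norml -[leRHS]normr1 -ler_sqr ?nnegrE //.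
rewrite -!normrX !ger0_norm ?sqr_ge0 // expr1n -sx /sqn (bigD1 i) //= lerDl.
by apply: sumr_ge0 => j _; rewrite sqr_ge0.
Qed.

Lemma rayleigh_max : (0 < n)%N ->
  exists2 c, sqn c = 1 & forall x, quad x <= quad c * sqn x.
Proof.
move=> n0; pose i0 := Ordinal n0.
have [|c] := EVT_max_rV _ sphere_compact (continuous_subspaceT quad_continuous).
  exists (\row_j (j == i0)%:R) => /=; rewrite /sqn (bigD1 i0) //= mxE eqxx expr1n.
  by rewrite big1 ?addr0 // => j /negbTE ji; rewrite mxE ji expr0n.
rewrite inE /= => c1 cmax; exists c => // x.
have [x0|xn0] := eqVneq (sqn x) 0.
  rewrite x0 mulr0 /quad big1 // => i _; rewrite big1 // => j _.
  have /eqP := x0; rewrite psumr_eq0 => [|k _]; last by rewrite sqr_ge0.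
  by move=> /allP /(_ i (mem_index_enum i)) /=; rewrite sqrf_eq0 => /eqP ->; rewrite !mul0r.
have N0 : 0 < sqn x.
  by rewrite lt_neqAle eq_sym xn0 /=; apply: sumr_ge0 => i _; rewrite sqr_ge0.
set s := Num.sqrt (sqn x); have s2 : s ^+ 2 = sqn x by rewrite sqr_sqrtr // ltW.
have s0 : s != 0 by rewrite -sqrf_eq0 s2.
pose z := s^-1 *: x.
have z1 : sqn z = 1.
  rewrite /sqn (eq_bigr (fun i => s ^- 2 * x 0 i ^+ 2)); last first.
    by move=> i _; rewrite mxE exprMn exprVn.
  by rewrite -mulr_sumr -/(sqn x) -s2 mulVf // expf_neq0.
have qz : quad z = quad x / sqn x.
  rewrite /quad mulr_suml; apply: eq_bigr => i _; rewrite mulr_suml.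
  by apply: eq_bigr => j _; rewrite !mxE -s2; field.
by have := cmax z; rewrite inE => /(_ z1); rewrite qz ler_pdivrMr.
Qed.

(** The first-order condition at a maximum of a quadratic form. *)
Lemma zero_of_quadratic (a b : R) : (forall s, 2 * s * a <= s ^+ 2 * b) -> a = 0.
Proof.
move=> H; apply/eqP; rewrite -sqrf_eq0 eq_le sqr_ge0 andbT.
have c0 : 0 < 1 + `|b| by rewrite ltr_pwDl.
have := H (a / (1 + `|b|)).
have -> : 2 * (a / (1 + `|b|)) * a = a ^+ 2 * 2 / (1 + `|b|) by field; rewrite gt_eqF.
have -> : (a / (1 + `|b|)) ^+ 2 * b = a ^+ 2 * (b / (1 + `|b|)) / (1 + `|b|).
  by field; rewrite gt_eqF.
rewrite ler_pM2r ?invr_gt0 // => H1.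
have b1 : b / (1 + `|b|) <= 1.
  by rewrite ler_pdivrMr // mul1r (le_trans (ler_norm b)) // lerDr.
by have := sqr_ge0 a; nra.
Qed.

(** As the entries of [A] are nonnegative, the entrywise absolute value of a
    maximizer of the Rayleigh quotient is again a maximizer. *)
Lemma nonneg_eigenvector : (0 < n)%N ->
  exists (y : 'rV[R]_n) (t : R),
    [/\ y != 0, forall i, 0 <= y 0 i & y *m A = t *: y].
Proof.
move=> n0; have [c c1 cmax] := rayleigh_max n0.
set t := quad c in cmax; pose y : 'rV[R]_n := \row_i `|c 0 i|.
have y1 : sqn y = 1.
  by rewrite -c1; apply: eq_bigr => i _; rewrite mxE real_normK ?num_real.
have qy : quad y = t.
  apply/eqP; rewrite eq_le; apply/andP; split.
    by have := cmax y; rewrite y1 mulr1.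
  apply: ler_sum => i _; apply: ler_sum => j _; rewrite !mxE.
  rewrite -[A i j in leRHS]ger0_norm ?A_ge0 // -!normrM.
  exact: ler_norm.
exists y, t; split.
- apply/eqP => y0; move: y1; rewrite y0 /sqn big1 => [/eqP|i _].
    by rewrite eq_sym oner_eq0.
  by rewrite mxE expr0n.
- by move=> i; rewrite mxE.
apply/rowP => i; rewrite !mxE; apply/eqP; rewrite -subr_eq0; apply/eqP.
apply: (@zero_of_quadratic _ (t - A i i)) => s.
pose z : 'rV[R]_n := \row_j (y 0 j + s * (j == i)%:R).
have zE j : z 0 j = y 0 j + s * (j == i)%:R by rewrite mxE.
have pick (F : 'I_n -> R) : \sum_j F j * (j == i)%:R = F i.
  rewrite (bigD1 i) //= eqxx mulr1 big1 ?addr0 // => j /negbTE ->.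
  by rewrite mulr0.
have sz : sqn z = 1 + 2 * s * y 0 i + s ^+ 2.
  rewrite -[X in _ = X + _ + _]y1 /sqn (eq_bigr (fun j => y 0 j ^+ 2 +
     ((2 * s * y 0 j) * (j == i)%:R + s ^+ 2 * (j == i)%:R))); last first.
    by move=> j _; rewrite zE; case: (j == i); rewrite /= ?mulr1 ?mulr0; ring.
  by rewrite !big_split /= !pick addrA.
have row_sum : (\sum_j y 0 j * A j i) = \sum_j A i j * y 0 j.
  by apply: eq_bigr => j _; rewrite mulrC A_sym.
have qz : quad z = t + 2 * s * (\sum_j y 0 j * A j i) + s ^+ 2 * A i i.
  have -> : quad z = \sum_k (\sum_j y 0 k * A k j * y 0 j
      + (s * (y 0 k * A k i) + (s * (\sum_j A k j * y 0 j) + s ^+ 2 * A k i) * (k == i)%:R)).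
    apply: eq_bigr => k _.
    rewrite (eq_bigr (fun j => y 0 k * A k j * y 0 j + ((s * (y 0 k * A k j)) * (j == i)%:R
      + (s * (k == i)%:R * (A k j * y 0 j)
         + s ^+ 2 * A k j * (k == i)%:R * (j == i)%:R)))); last first.
      by move=> j _; rewrite !zE; ring.
    rewrite !big_split /= !pick -mulr_sumr; ring.
  rewrite !big_split /= pick -/(quad y) qy -mulr_sumr -row_sum; ring.
have := cmax z; rewrite qz sz [y 0 i]mxE; lra.
Qed.

End SymmetricMatrix.

Section SpectralRadius.
Variables (R : realType) (V : finType) (e : rel V).
Hypothesis e_sym : symmetric e.

Let A := adjacency R e.

Lemma adjacency_sym i j : A i j = A j i.
Proof. by rewrite !mxE e_sym. Qed.

Lemma sum_adjacency (F : V -> R) (v : V) :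
  \sum_(j < #|V|) F (enum_val j) * A j (enum_rank v) = \sum_(u | e v u) F u.
Proof.
rewrite (reindex (@enum_rank V)) /=; last exact/onW_bij/enum_rank_bij.
rewrite [RHS]big_mkcond; apply: eq_bigr => u _.
by rewrite !mxE !enum_rankK e_sym; case: (e v u); rewrite ?mulr1 ?mulr0.
Qed.

Lemma normr_normc (z : R[i]) : `|z| = (ComplexField.Normc.normc z)%:C%C.
Proof. by case: z => a b; rewrite normc_def. Qed.

(** Read off at a coordinate of largest modulus, the eigenvalue equation bounds
    the eigenvalue by a column sum. *)
Lemma eigenvalue_le_degree (a : R[i]) :
  eigenvalue (map_mx (real_complex R) A) a ->
  ComplexField.Normc.normc a <= (max_degree e)%:R.
Proof.
move=> /eigenvalueP[x xA x0].
have [i xi] : exists i, x 0 i != 0.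
  by apply/existsP; apply: contraNT x0; rewrite negb_exists => /forallP x0;
     apply/eqP/rowP => i; apply/eqP; move: (x0 i); rewrite negbK mxE.
pose m := [arg max_(j > i) ComplexField.Normc.normc (x 0 j)]%O.
have mmax j : `|x 0 j| <= `|x 0 m|.
  rewrite !normr_normc lecR /m; case: arg_maxP => // k _; exact.
have m0 : 0 < `|x 0 m|.
  by apply: lt_le_trans (mmax i); rewrite normr_gt0.
rewrite -lecR -normr_normc -(ler_pM2r m0) -normrM.
have := congr1 (fun y : 'rV_#|V| => y 0 m) xA; rewrite !mxE => <-.
apply: (le_trans (ler_norm_sum _ _ _)).
apply: (@le_trans _ _ (\sum_j `|x 0 m| * (A j m)%:C%C)).
  apply: ler_sum => j _; rewrite !mxE normrM ler_pM //.
  by case: (e _ _); rewrite ?rmorph1 ?rmorph0 ?normr1 ?normr0.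
rewrite -mulr_sumr mulrC ler_pM2r // -rmorph_sum /= lecR.
have := sum_adjacency (fun=> 1) (enum_val m); rewrite enum_valK.
rewrite (eq_bigr (fun j => A j m)) => [->|j _]; last by rewrite mul1r.
rewrite sumr_const ler_nat; exact: leq_bigmax.
Qed.

Let rho := spectral_radius A.

Lemma eigenvalue_le_spectral_radius (t : R) (y : 'rV[R]_#|V|) :
  y != 0 -> y *m A = t *: y -> t <= rho /\ rho <= (max_degree e)%:R.
Proof.
move=> y0 yA; set S := [set ComplexField.Normc.normc a
  | a in [set a : R[i] | eigenvalue (map_mx (real_complex R) A) a]]%classic.
have S1 : ubound S (max_degree e)%:R.
  by move=> _ [a /= /eigenvalue_le_degree ? <-].
have St : S (ComplexField.Normc.normc (t%:C)%C).
  exists (t%:C)%C => //=; apply/eigenvalueP; exists (map_mx (real_complex R) y).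
    by rewrite -map_mxM yA map_mxZ.
  by rewrite map_mx_eq0.
split; last by apply: ge_sup => //; exists (ComplexField.Normc.normc (t%:C)%C).
apply: le_trans (ub_le_sup _ St); last by exists (max_degree e)%:R.
by rewrite /= expr0n addr0 sqrtr_sqr ler_norm.
Qed.

(** On a connected graph a nonnegative eigenvector is positive, since the set
    of its zeros is closed under adjacency. *)
Lemma perron : (0 < #|V|)%N -> (forall u v : V, connect e u v) ->
  exists f : V -> R, [/\ forall v, 0 < f v,
    forall v, \sum_(u | e v u) f u <= rho * f v & rho <= (max_degree e)%:R].
Proof.
move=> V0 conn.
have A0 i j : 0 <= A i j by rewrite mxE.
have [y [t [y0 yge yA]]] := nonneg_eigenvector adjacency_sym A0 V0.
have [t_rho rho_deg] := eigenvalue_le_spectral_radius y0 yA.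
pose f v := y 0 (enum_rank v).
have fA v : \sum_(u | e v u) f u = t * f v.
  have := congr1 (fun z : 'rV_#|V| => z 0 (enum_rank v)) yA; rewrite !mxE => <-.
  by rewrite -sum_adjacency; apply: eq_bigr => j _; rewrite /f enum_valK.
have f0 v : 0 <= f v by exact: yge.
have step v u : e v u -> f v = 0 -> f u = 0.
  move=> evu fv; have /eqP := fA v; rewrite fv mulr0 psumr_eq0 => [|w _ //].
  by move=> /allP /(_ u (mem_index_enum u)); rewrite evu => /eqP.
have fpos v : 0 < f v.
  rewrite lt_neqAle f0 andbT eq_sym; apply/eqP => fv; case/eqP: y0.
  apply/rowP => i; have <- : f (enum_val i) = y 0 i by rewrite /f enum_valK.
  rewrite mxE.
  have /connectP[p] := conn v (enum_val i).
  elim: p v fv => [|w p IH] v fv /= => [_ -> //|/andP[evw] pw].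
  by apply: IH pw; exact: step evw fv.
exists f; split => // v; rewrite fA.
by rewrite ler_wpM2r.
Qed.

End SpectralRadius.

(** * The hard-core model on a set of vertices *)

Section PartitionFunction.
Variables (R : realType) (V : finType) (e : rel V) (lam : R).
Hypotheses (e_sym : symmetric e) (e_irr : irreflexive e) (lam_gt0 : 0 < lam).

Implicit Types (S I J : {set V}) (u v w : V) (f g : {set V} -> R).

Definition nbrs v : {set V} := [set w | e v w].

Definition indep_set I : bool := [forall u in I, forall w in I, ~~ e u w].

Definition weight I : R := (indep_set I)%:R * lam ^+ #|I|.

Definition wsum S f : R := \sum_(I : {set V} | I \subset S) weight I * f I.

Definition partition S : R := wsum S (fun=> 1).

Definition mean S f : R := wsum S f / partition S.

(** Conditioning the model on [S] on the spin of [v] leaves the model on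
    [cond0 S v] if [v] is empty and on [cond1 S v] if it is occupied; in the
    latter case a function [f] of the configuration becomes [add v f]. *)
Definition cond0 S v : {set V} := S :\ v.
Definition cond1 S v : {set V} := S :\ v :\: nbrs v.
Definition add v f I : R := f (v |: I).
Definition ind w I : R := (w \in I)%:R.

Definition occ S v : R := lam * partition (cond1 S v) / partition S.

(** At [f = ind w] this is the entry [(v, w)] of the influence matrix on [S]. *)
Definition infl S v f : R := mean (cond1 S v) (add v f) - mean (cond0 S v) f.

Lemma weight_ge0 I : 0 <= weight I.
Proof. by rewrite /weight mulr_ge0 // exprn_ge0 // ltW. Qed.

Lemma weight0 : weight finset.set0 = 1.
Proof.
rewrite /weight finset.cards0 expr0 mulr1.
suff -> : indep_set finset.set0 by [].
by apply/forall_inP => u; rewrite finset.inE.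
Qed.

Lemma weight_add v I : v \notin I ->
  weight (v |: I) = if I \subset ~: nbrs v then lam * weight I else 0.
Proof.
move=> vI; rewrite /weight finset.cardsU1 vI exprD expr1.
case: ifPn => [/fintype.subsetP sIN | nsIN].
  rewrite mulrCA; congr (_ * (_ * _)); congr (_%:R); congr (nat_of_bool _).
  have nev u : u \in I -> ~~ e v u by move=> /sIN; rewrite !finset.inE.
  apply/forall_inP/forall_inP => H u uI.
    apply/forall_inP => w wI.
    by move/forall_inP: (H u (finset.setU1r _ uI)) => /(_ w (finset.setU1r _ wI)).
  apply/forall_inP => w; case/finset.setU1P: uI => [->|uI].
    by case/finset.setU1P => [->|/nev //]; rewrite e_irr.
  case/finset.setU1P => [->|wI]; first by rewrite e_sym nev.
  by move/forall_inP: (H u uI) => /(_ w wI).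
suff -> : indep_set (v |: I) = false by rewrite mul0r.
apply/negbTE; case/subsetPn: nsIN => u uI; rewrite !finset.inE negbK => evu.
rewrite /indep_set negb_forall_in; apply/exists_inP; exists v.
  by rewrite finset.setU11.
by rewrite negb_forall_in; apply/exists_inP; exists u; rewrite ?finset.setU1r ?negbK.
Qed.

Lemma notin_cond0 S v I : I \subset cond0 S v -> v \notin I.
Proof. by rewrite subsetD1 => /andP[]. Qed.

Lemma cond1_cond0 S v : cond1 S v \subset cond0 S v.
Proof. exact: finset.subsetDl. Qed.

Lemma notin_cond1 S v I : I \subset cond1 S v -> v \notin I.
Proof. by move=> /fintype.subset_trans /(_ (cond1_cond0 _ _)); apply: notin_cond0. Qed.

Lemma sub_cond1 S v I :
  (I \subset cond1 S v) = (I \subset cond0 S v) && (I \subset ~: nbrs v).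
Proof. by rewrite /cond1 /cond0 finset.setDE finset.subsetI. Qed.

Lemma eq_wsum S f g : (forall I, I \subset S -> f I = g I) ->
  wsum S f = wsum S g.
Proof. by move=> fg; apply: eq_bigr => I /fg ->. Qed.

Lemma wsumD S f g : wsum S (fun I => f I + g I) = wsum S f + wsum S g.
Proof. by rewrite /wsum -big_split; apply: eq_bigr => I _; rewrite mulrDr. Qed.

Lemma wsumZ S c f : wsum S (fun I => c * f I) = c * wsum S f.
Proof. by rewrite /wsum mulr_sumr; apply: eq_bigr => I _; rewrite mulrCA. Qed.

Lemma wsumB S f g : wsum S (fun I => f I - g I) = wsum S f - wsum S g.
Proof.
by rewrite -mulN1r -wsumZ -wsumD; apply: eq_wsum => I _; rewrite mulN1r.
Qed.

Lemma wsum_sum S (T : Type) (r : seq T) (P : pred T) (F : T -> {set V} -> R) :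
  wsum S (fun I => \sum_(i <- r | P i) F i I) = \sum_(i <- r | P i) wsum S (F i).
Proof.
rewrite /wsum exchange_big; apply: eq_bigr => I _.
by rewrite mulr_sumr.
Qed.

Lemma wsum_const S c : wsum S (fun=> c) = c * partition S.
Proof. by rewrite /partition -wsumZ; apply: eq_wsum => I _; rewrite mulr1. Qed.

Lemma wsum_ge0 S f : (forall I, I \subset S -> 0 <= f I) -> 0 <= wsum S f.
Proof. by move=> f0; apply: sumr_ge0 => I IS; rewrite mulr_ge0 ?weight_ge0 ?f0. Qed.

Lemma le_wsum S f g : (forall I, I \subset S -> f I <= g I) ->
  wsum S f <= wsum S g.
Proof.
move=> fg; rewrite -subr_ge0 -wsumB.
by apply: wsum_ge0 => I /fg; rewrite subr_ge0.
Qed.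

(** An independent subset of [S] either avoids [v], or contains [v] and then
    avoids its neighbours; every recursion below comes from this identity. *)
Lemma wsum_split S v f : v \in S ->
  wsum S f = wsum (cond0 S v) f + lam * wsum (cond1 S v) (add v f).
Proof.
move=> vS; rewrite {1}/wsum (bigID (fun I => v \notin I)) /=; congr (_ + _).
  by apply: eq_bigl => I; rewrite subsetD1.
rewrite (reindex_onto (fun J => v |: J) (fun I => I :\ v)) /=; last first.
  by move=> I /andP[_]; rewrite negbK => vI; rewrite finset.setD1K.
rewrite (eq_bigl (fun J => J \subset cond0 S v)); last first.
  move=> J; rewrite finset.setU11 andbT finset.subUset finset.sub1set vS subsetD1 /=.
  case: (boolP (v \in J)) => vJ /=; last first.
    by rewrite finset.setU1K // eqxx.
  rewrite andbF; apply/negbTE/negP => /andP[_ /eqP E].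
  by move: vJ; rewrite -E !finset.inE eqxx.
rewrite (bigID (fun J => J \subset ~: nbrs v)) /= addrC big1 ?add0r; last first.
  move=> J /andP[/notin_cond0 vJ /negbTE H].
  by rewrite weight_add // H mul0r.
rewrite /wsum mulr_sumr; apply: eq_big => [J|J]; first by rewrite sub_cond1.
by move=> /andP[/notin_cond0 vJ H]; rewrite weight_add // H mulrA.
Qed.

Lemma partition_ge1 S : 1 <= partition S.
Proof.
rewrite /partition /wsum (bigD1 finset.set0) /=; last exact: finset.sub0set.
rewrite weight0 mulr1 lerDl; apply: sumr_ge0 => I _.
by rewrite mulr1 weight_ge0.
Qed.

Lemma partition_gt0 S : 0 < partition S.
Proof. exact: lt_le_trans ltr01 (partition_ge1 S). Qed.
Hint Resolve partition_gt0 : core.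

Lemma partition_neq0 S : partition S != 0.
Proof. by rewrite gt_eqF. Qed.

Lemma partition_split S v : v \in S ->
  partition S = partition (cond0 S v) + lam * partition (cond1 S v).
Proof. exact: wsum_split. Qed.

Lemma wsum_sub (S T : {set V}) f : S \subset T -> (forall I, 0 <= f I) ->
  wsum S f <= wsum T f.
Proof.
move=> sST f0; rewrite /wsum [leRHS](bigID (fun I => I \subset S)) /=.
rewrite -[leLHS]addr0; apply: lerD.
  rewrite [leRHS](eq_bigl (fun I => I \subset S)) // => I.
  case: (boolP (I \subset S)) => [IS|]; last by rewrite andbF.
  by rewrite (fintype.subset_trans IS sST).
by apply: sumr_ge0 => I _; rewrite mulr_ge0 ?weight_ge0.
Qed.

Lemma eq_mean S f g : (forall I, I \subset S -> f I = g I) -> mean S f = mean S g.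
Proof. by move=> fg; rewrite /mean (eq_wsum fg). Qed.

Lemma wsum_mean S f : wsum S f = partition S * mean S f.
Proof. by rewrite /mean mulrCA divff ?mulr1 ?partition_neq0. Qed.

Lemma meanD S f g : mean S (fun I => f I + g I) = mean S f + mean S g.
Proof. by rewrite /mean wsumD mulrDl. Qed.

Lemma meanB S f g : mean S (fun I => f I - g I) = mean S f - mean S g.
Proof. by rewrite /mean wsumB mulrBl. Qed.

Lemma meanZ S c f : mean S (fun I => c * f I) = c * mean S f.
Proof. by rewrite /mean wsumZ mulrA. Qed.

Lemma mean_const S c : mean S (fun=> c) = c.
Proof. by rewrite /mean wsum_const mulfK ?partition_neq0. Qed.

Lemma mean_sum S (T : Type) (r : seq T) (P : pred T) (F : T -> {set V} -> R) :
  mean S (fun I => \sum_(i <- r | P i) F i I) = \sum_(i <- r | P i) mean S (F i).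
Proof. by rewrite /mean wsum_sum mulr_suml. Qed.

Lemma mean_ge0 S f : (forall I, I \subset S -> 0 <= f I) -> 0 <= mean S f.
Proof. by move=> f0; rewrite divr_ge0 ?wsum_ge0 // ltW. Qed.

Lemma le_mean S f g : (forall I, I \subset S -> f I <= g I) ->
  mean S f <= mean S g.
Proof. by move=> fg; rewrite ler_pM2r ?invr_gt0 // le_wsum. Qed.

Lemma occ_gt0 S v : 0 < occ S v.
Proof. by rewrite divr_gt0 // mulr_gt0. Qed.

Lemma occ_compl S v : v \in S -> 1 - occ S v = partition (cond0 S v) / partition S.
Proof.
move=> vS; rewrite /occ -{1}(divff (partition_neq0 S)) -mulrBl.
by rewrite [X in X - _](partition_split vS) addrK.
Qed.

Lemma occ_lt1 S v : v \in S -> occ S v < 1.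
Proof. by move=> vS; rewrite -subr_gt0 occ_compl // divr_gt0. Qed.

Lemma occ_odds S v : v \in S ->
  occ S v / (1 - occ S v) = lam * partition (cond1 S v) / partition (cond0 S v).
Proof.
move=> vS; rewrite occ_compl // /occ invf_div mulrA -(mulrA _ _^-1).
by rewrite mulVf ?mulr1 ?partition_neq0.
Qed.

Lemma occ_le S v : v \in S -> occ S v <= lam / (1 + lam).
Proof.
move=> vS; rewrite ler_pdivlMr ?addr_gt0 // /occ mulrAC ler_pdivrMr //.
have H : partition (cond1 S v) <= partition (cond0 S v).
  by apply: wsum_sub => //; exact: cond1_cond0.
rewrite [X in _ <= _ * X](partition_split vS) -mulrA ler_pM2l //.
by lra.
Qed.

Lemma occ_le_lam S v : v \in S -> occ S v <= lam.
Proof.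
move=> /occ_le H; apply: (le_trans H).
by rewrite ler_pdivrMr ?addr_gt0 // ler_peMr ?(ltW lam_gt0) // lerDl ltW.
Qed.

Lemma mean_split S v f : v \in S ->
  mean S f = (1 - occ S v) * mean (cond0 S v) f
             + occ S v * mean (cond1 S v) (add v f).
Proof.
move=> vS; rewrite occ_compl // /occ {1}/mean (wsum_split _ vS) mulrDl !wsum_mean.
by rewrite mulrA; congr (_ + _); rewrite mulrAC.
Qed.

Lemma mean_infl S v f : v \in S ->
  mean S f - mean (cond0 S v) f = occ S v * infl S v f.
Proof. by move=> vS; rewrite (mean_split _ vS) /infl; ring. Qed.

Definition cov S f g : R := mean S (fun I => f I * g I) - mean S f * mean S g.
Definition var S f : R := cov S f f.

Lemma cov_split S v f g : v \in S ->
  cov S f g = (1 - occ S v) * cov (cond0 S v) f g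
     + occ S v * cov (cond1 S v) (add v f) (add v g)
     + occ S v * (1 - occ S v) * infl S v f * infl S v g.
Proof. by move=> vS; rewrite /cov !(mean_split _ vS) /infl /add; ring. Qed.

Lemma infl_ind S v : infl S v (ind v) = 1.
Proof.
rewrite /infl (@eq_mean _ _ (fun=> 1)) ?mean_const; last first.
  by move=> I _; rewrite /add /ind finset.setU11.
rewrite (@eq_mean _ _ (fun=> 0)) ?mean_const ?subr0 // => I IS.
by rewrite /ind (negbTE (notin_cond0 IS)).
Qed.

Lemma add_ind v w I : w != v -> add v (ind w) I = ind w I.
Proof. by move=> wv; rewrite /add /ind finset.in_setU1 (negbTE wv). Qed.

Lemma infl_ind_neq S v w : w != v ->
  infl S v (ind w) = mean (cond1 S v) (ind w) - mean (cond0 S v) (ind w).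
Proof.
by move=> wv; congr (_ - _); apply: eq_mean => I _; rewrite add_ind.
Qed.

Lemma mean_ind_notin S w : w \notin S -> mean S (ind w) = 0.
Proof.
move=> wS; rewrite (@eq_mean _ _ (fun=> 0)) ?mean_const // => I IS.
by rewrite /ind; case: (boolP (w \in I)) => // /(fintype.subsetP IS); rewrite (negbTE wS).
Qed.

Lemma mean_ind S w : w \in S -> mean S (ind w) = occ S w.
Proof.
move=> wS; rewrite (mean_split _ wS) (mean_ind_notin (S := cond0 S w)).
  rewrite mulr0 add0r (@eq_mean _ _ (fun=> 1)) ?mean_const ?mulr1 //.
  by move=> I _; rewrite /add /ind finset.setU11.
by rewrite !finset.inE eqxx.
Qed.

Lemma cov_ind S v f : v \in S ->
  cov S f (ind v) = occ S v * (1 - occ S v) * infl S v f.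
Proof.
move=> vS; rewrite (cov_split _ _ vS) infl_ind mulr1 /cov.
have -> : mean (cond0 S v) (fun I => f I * ind v I) = 0.
  rewrite (@eq_mean _ _ (fun=> 0)) ?mean_const // => I IS.
  by rewrite /ind (negbTE (notin_cond0 IS)) mulr0.
have -> : mean (cond0 S v) (ind v) = 0 by rewrite mean_ind_notin ?finset.inE ?eqxx.
have addv I : add v (ind v) I = 1 by rewrite /add /ind finset.setU11.
rewrite (@eq_mean _ (add v (ind v)) (fun=> 1)) // mean_const.
rewrite (@eq_mean _ (fun I => add v f I * _ I) (add v f)) => [|I _].
  by rewrite !mulr0 mulr1 !subrr mulr0 !add0r mulr0 add0r.
by rewrite addv mulr1.
Qed.

Lemma covC S f g : cov S f g = cov S g f.
Proof.
by rewrite /cov [mean S f * _]mulrC; congr (_ - _); apply: eq_mean => I _; rewrite mulrC.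
Qed.

(** * Weitz's recursion and the total influence of a vertex *)

Definition abs_infl S (g : V -> R) v : R :=
  \sum_(w : V) `|infl S v (ind w)| * g w.

(** Deleting the vertices [us] one at a time, [p u] is the occupation probability
    of [u] just before its deletion. *)
Lemma occ_telescope (g : V -> R) (K : R) (us : seq V) S :
  (forall w, 0 <= g w) -> uniq us -> {subset us <= S} ->
  (forall (T : {set V}) u, T \subset S -> u \in T ->
     Num.sqrt (occ T u) * abs_infl T g u <= K * g u) ->
  exists p : V -> R,
    [/\ forall u, u \in us -> 0 < p u < 1 /\ p u <= lam,
        partition (S :\: [set x in us])
          = partition S * \prod_(u <- us) (1 - p u)
      & \sum_w `|mean (S :\: [set x in us]) (ind w) - mean S (ind w)| * g w
          <= K * \sum_(u <- us) Num.sqrt (p u) * g u].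
Proof.
move=> g0; elim: us S => [|u us IH] S /=.
  move=> _ _ _; exists (fun=> 0).
  have -> : S :\: [set x in [::]] = S.
    by apply/finset.setP => x; rewrite !finset.inE in_nil.
  split=> //; first by rewrite big_nil mulr1.
  rewrite big_nil mulr0 big1 // => w _.
  by rewrite subrr normr0 mul0r.
move=> /andP[uus uniq_us] sub bound.
have uS : u \in S by apply: sub; rewrite mem_head.
have setE : S :\: [set x in u :: us] = cond0 S u :\: [set x in us].
  by apply/finset.setP => x; rewrite !finset.inE negb_or; case: (x == u); rewrite //= !andbF.
have sub' : {subset us <= cond0 S u}.
  move=> x xus; rewrite !finset.inE sub ?andbT; last by rewrite in_cons xus orbT.
  by apply: contraNneq uus => <-.
have [|p [p01 pZ psum]] := IH (cond0 S u) uniq_us sub'.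
  by move=> T x TS; apply: bound; apply: (fintype.subset_trans TS); exact: finset.subD1set.
exists (fun x => if x == u then occ S u else p x).
have pE x : x \in us -> (if x == u then occ S u else p x) = p x.
  by move=> xus; case: eqP => // xu; rewrite -xu xus in uus.
split.
- move=> x; rewrite in_cons; case: eqP => [_ _|_ /= /p01 //].
  by rewrite occ_gt0 occ_lt1 // occ_le_lam.
- rewrite setE pZ big_cons eqxx mulrA occ_compl // [partition S * _]mulrCA.
  rewrite divff ?partition_neq0 // mulr1.
  by congr (_ * _); apply: eq_big_seq => x /pE ->.
rewrite setE big_cons eqxx mulrDr.
under [X in _ <= _ + _ * X]eq_big_seq => x xus do rewrite pE //.
rewrite addrC.
apply: (@le_trans _ _ (\sum_w
   (`|mean (cond0 S u :\: [set x in us]) (ind w) - mean (cond0 S u) (ind w)| * g w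
   + occ S u * (`|infl S u (ind w)| * g w)))).
  apply: ler_sum => w _; rewrite mulrA -mulrDl ler_wpM2r //.
  rewrite -[occ S u]gtr0_norm ?occ_gt0 // -normrM -mean_infl // [`|mean S _ - _|]distrC.
  by apply: le_trans (ler_normD _ _); rewrite addrA subrK.
rewrite big_split lerD //= -mulr_sumr -/(abs_infl S g u).
rewrite -{1}[occ S u]sqr_sqrtr ?(ltW (occ_gt0 _ _)) // expr2 -mulrA [K * _]mulrCA.
by rewrite ler_wpM2l ?sqrtr_ge0 // bound.
Qed.

(** Weitz's recursion: once [v] is occupied instead of empty, its neighbours are
    deleted, and deleting [u] changes the occupation probability of any other
    vertex by the influence of [u] times the current occupation probability of
    [u]. *)
Lemma influence_recursion (g : V -> R) (K : R) S v :
  (forall w, 0 <= g w) -> v \in S ->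
  (forall (T : {set V}) u, T \subset cond0 S v -> u \in T ->
     Num.sqrt (occ T u) * abs_infl T g u <= K * g u) ->
  exists p : V -> R, let A := nbrs v :&: S in
    let odds := lam * \prod_(u in A) (1 - p u) in
    [/\ forall u, u \in A -> 0 < p u < 1 /\ p u <= lam,
        occ S v = odds / (1 + odds)
      & abs_infl S g v <= g v + K * \sum_(u in A) Num.sqrt (p u) * g u].
Proof.
move=> g0 vS bound; set A := nbrs v :&: S.
have vA : v \notin A by rewrite !finset.inE e_irr.
have subA : {subset enum A <= cond0 S v}.
  move=> u; rewrite mem_enum => uA; rewrite !finset.inE.
  have -> : u != v by apply: contraNneq vA => <-.
  by move: uA; rewrite !finset.inE => /andP[].
have setE : cond0 S v :\: [set x in enum A] = cond1 S v.
  apply/finset.setP => x; rewrite !finset.inE mem_enum !finset.inE.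
  by case: (e v x) => //=; case: (x \in S) => //=; rewrite andbF.
have [p [p01 pZ psum]] := occ_telescope g0 (enum_uniq A) subA bound.
rewrite setE big_enum in pZ; rewrite setE big_enum /= in psum.
exists p; split.
- by move=> u uA; apply: p01; rewrite mem_enum.
- have <- : occ S v / (1 - occ S v) = lam * \prod_(u in A) (1 - p u).
    by rewrite occ_odds // pZ [lam * _]mulrCA mulrAC divff ?partition_neq0 // mul1r.
  have : 1 - occ S v != 0 by rewrite gt_eqF // subr_gt0 occ_lt1.
  by move=> q0; field; rewrite q0 subrK oner_neq0.
rewrite /abs_infl (bigD1 v) //= infl_ind normr1 mul1r lerD2l.
apply: le_trans psum; rewrite [leRHS](bigD1 v) //= -[leLHS]add0r lerD ?mulr_ge0 //.
by apply: ler_sum => w wv; rewrite infl_ind_neq.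
Qed.

(** A step of the recursion costs the occupation probability of the child.  One
    factor [Num.sqrt] of it is the potential of the child, the other one enters
    the one-step contraction, and [K] bounds the resulting geometric series. *)
Lemma influence_bound (g : V -> R) (theta K : R) :
  (forall w, 0 <= g w) -> 0 <= K -> Num.sqrt lam + K * theta <= K ->
  (forall v (A : {set V}) (p : V -> R), A \subset nbrs v ->
     (forall u, u \in A -> 0 < p u < 1) ->
     let odds := lam * \prod_(u in A) (1 - p u) in
     Num.sqrt (odds / (1 + odds)) * \sum_(u in A) Num.sqrt (p u) * g u
       <= theta * g v) ->
  forall S v, v \in S -> Num.sqrt (occ S v) * abs_infl S g v <= K * g v.
Proof.
move=> g0 K0 HK contr S; have [m] := ubnP #|S|; elim: m S => // m IH S Sm v vS.
have [|p /= [p01 occE infl_le]] := @influence_recursion g K S v g0 vS.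
  move=> T u TS; apply: IH.
  rewrite (leq_ltn_trans (subset_leq_card TS)) // -ltnS (leq_trans _ Sm) //.
  by rewrite ltnS (cardsD1 v S) vS.
have /= C := contr v (nbrs v :&: S) p (finset.subsetIl _ _) (fun u uA => (p01 u uA).1).
apply: (le_trans (ler_wpM2l (sqrtr_ge0 _) infl_le)); rewrite mulrDr.
apply: (@le_trans _ _ (Num.sqrt lam * g v + K * (theta * g v))); last first.
  by rewrite mulrA -mulrDl ler_wpM2r.
apply: lerD; first by rewrite ler_wpM2r // ler_wsqrtr // occ_le_lam.
by rewrite mulrCA ler_wpM2l // occE.
Qed.

Lemma card_nbrs v : (#|nbrs v| <= max_degree e)%N.
Proof.
have -> : #|nbrs v| = #|[pred w | e v w]|.
  by apply: eq_card => w; rewrite finset.inE.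
exact: leq_bigmax.
Qed.

(** The contraction factor, and the resulting constant in [eta]. *)
Definition rate (eps : R) : R := Num.sqrt (1 - eps / 10).

Definition infl_const (eps : R) : R := 18 / (1 - rate eps).

Lemma rate_lt1 (eps : R) : 0 < eps -> eps < 1 -> rate eps < 1.
Proof.
move=> e0 e1; rewrite /rate -[X in _ < X]sqrtr1 ltr_sqrt //; lra.
Qed.

Lemma infl_const_gt0 (eps : R) : 0 < eps -> eps < 1 -> 0 < infl_const eps.
Proof. by move=> e0 e1; rewrite divr_gt0 // subr_gt0 rate_lt1. Qed.

(** Below the root, [contraction] applies since [f] is a positive vector with
    [A f <= k f].  At the root no potential is available; Hoelder's inequality
    over its at most [max_degree e] neighbours costs
    [(max_degree e / k) `^ hexp k], and [hexp k <= 1 / 2]. *)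
Lemma total_influence (k eps : R) (f : V -> R) S v :
  2 <= k -> 0 < eps -> eps < 1 -> lam <= (1 - eps) * lambda_c k ->
  (forall v, 0 < f v) -> (forall v, \sum_(u | e v u) f u <= k * f v) ->
  k <= (max_degree e)%:R -> v \in S ->
  abs_infl S (fun w => f w `^ (1 - hexp k)) v
    <= (1 + infl_const eps * Num.sqrt ((max_degree e)%:R / k)) * f v `^ (1 - hexp k).
Proof.
move=> k2 e0 e1 ll f0 fk kD vS; set g := fun w => _.
set theta := rate eps; have th1 : theta < 1 by exact: rate_lt1.
have th1' : 0 < 1 - theta by rewrite subr_gt0.
have k0 : 0 < k by lra.
have /andP[a0 a1] := hexp_bounds k2.
have b0 : 0 <= 1 - hexp k by lra.
set K := Num.sqrt lam / (1 - theta).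
have K0 : 0 <= K by rewrite divr_ge0 ?sqrtr_ge0 // ltW.
have g0 w : 0 <= g w by exact: powR_ge0.
have sumf w (A : {set V}) : A \subset nbrs w -> \sum_(u in A) f u <= k * f w.
  move=> /fintype.subsetP Aw; apply: le_trans (fk w).
  rewrite [leRHS](bigID (mem A)) /= -[leLHS]addr0 lerD //; last first.
    by apply: sumr_ge0 => u _; exact: ltW.
  rewrite [leRHS](eq_bigl (mem A)) // => u /=.
  by case: (boolP (u \in A)) => [/Aw|]; rewrite ?andbF // finset.inE => ->.
have bound : forall S v, v \in S -> Num.sqrt (occ S v) * abs_infl S g v <= K * g v.
  apply: (influence_bound (theta := theta)) => //.
    rewrite le_eqVlt; apply/orP; left; apply/eqP.
    by rewrite /K; field; rewrite gt_eqF.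
  move=> w A p Aw p01 /=.
  exact: (contraction k2 e0 e1 p01 f0 (f0 w) (sumf w A Aw) lam_gt0 ll).
have [|p /= [p01 _ H]] := @influence_recursion g K S v g0 vS.
  by move=> T u _; exact: bound.
apply: (le_trans H); rewrite mulrDl mul1r lerD2l.
set A := nbrs v :&: S in p01 *; set D := (max_degree e)%:R in kD *.
have p0 u : u \in A -> 0 < p u by move=> /p01[/andP[]].
have r0 := expo_gt0 k2.
have H1 : \sum_(u in A) Num.sqrt (p u) * g u
    <= (D * lam `^ expo k) `^ hexp k * (k * f v) `^ (1 - hexp k).
  apply: (le_trans (sum_sqrt_le k2 p0 f0)).
  have X0 : 0 <= \sum_(u in A) p u `^ expo k by apply: sumr_ge0 => u _; exact: powR_ge0.
  have S0 : 0 <= \sum_(u in A) f u by apply: sumr_ge0 => u _; exact: ltW.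
  have X1 : \sum_(u in A) p u `^ expo k <= D * lam `^ expo k.
    apply: (@le_trans _ _ (\sum_(u in A) lam `^ expo k)).
      apply: ler_sum => u uA.
      rewrite ge0_ler_powR ?nnegrE ?(ltW r0) ?(ltW lam_gt0) ?(ltW (p0 u uA)) //.
      by have [] := p01 u uA.
    rewrite sumr_const -mulr_natl ler_wpM2r ?powR_ge0 // ler_nat.
    by apply: leq_trans (card_nbrs v); apply: subset_leq_card; exact: finset.subsetIl.
  have S1 := sumf v A (finset.subsetIl _ _).
  apply: ler_pM; rewrite ?powR_ge0 //;
    by rewrite ge0_ler_powR ?nnegrE ?(ltW a0) ?(le_trans X0 X1) ?(le_trans S0 S1).
apply: (le_trans (ler_wpM2l K0 H1)).
have D0 : 0 < D by apply: lt_le_trans kD.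
rewrite [(D * _) `^ _]powRM ?powR_ge0 ?(ltW D0) // -powRrM expo_hexp //.
rewrite powRM ?(ltW k0) ?(ltW (f0 v)) //.
have -> : lam `^ (1 / 2) = Num.sqrt lam by rewrite -powR12_sqrt ?(ltW lam_gt0) // mul1r.
have -> : K * (D `^ hexp k * Num.sqrt lam * (k `^ (1 - hexp k) * f v `^ (1 - hexp k)))
   = lam * D `^ hexp k * k `^ (1 - hexp k) / (1 - theta) * g v.
  rewrite /K -[lam in RHS]sqr_sqrtr ?(ltW lam_gt0) // /g; field.
  by rewrite gt_eqF.
rewrite ler_wpM2r // /infl_const [leRHS]mulrAC ler_pM2r ?invr_gt0 //.
have lam18 : lam <= 18 / k.
  apply: (le_trans ll); apply: le_trans (lambda_c_le18 k2).
  by rewrite ler_piMl ?(ltW (lambda_c_gt0 k2)) //; lra.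
apply: (@le_trans _ _ (18 / k * D `^ hexp k * k `^ (1 - hexp k))).
  by rewrite ler_wpM2r ?powR_ge0 // ler_wpM2r ?powR_ge0.
have -> : 18 / k * D `^ hexp k * k `^ (1 - hexp k) = 18 * (D / k) `^ hexp k.
  rewrite powRB; last by rewrite (gt_eqF k0) implybT.
  rewrite powRr1 ?(ltW k0) //.
  have kV : k^-1 `^ hexp k = (k `^ hexp k)^-1.
    by rewrite -[k^-1]powR_inv1 ?(ltW k0) // -powRrM mulN1r powRN.
  rewrite [in RHS]powRM ?invr_ge0 ?(ltW k0) ?(ltW D0) // kV.
  by field; rewrite !gt_eqF ?powR_gt0.
rewrite ler_wpM2l // -powR12_sqrt ?divr_ge0 ?(ltW D0) ?(ltW k0) //.
by rewrite ler_powR //; [rewrite ler_pdivlMr // mul1r | lra].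
Qed.

(** * Spectral independence *)

Lemma var_sqr S f : var S f = mean S (fun I => (f I - mean S f) ^+ 2).
Proof.
rewrite /var /cov; set m := mean S f.
rewrite (@eq_mean _ (fun I => _ ^+ 2)
  (fun I => f I * f I + (- (2 * m) * f I + m ^+ 2))) => [|I _]; last by ring.
by rewrite !meanD meanZ mean_const -/m; ring.
Qed.

Lemma var_ge0 S f : 0 <= var S f.
Proof. by rewrite var_sqr; apply: mean_ge0 => I _; rewrite sqr_ge0. Qed.

Lemma cov_sumr S f (r : seq V) (P : pred V) (c : V -> R) (F : V -> {set V} -> R) :
  cov S f (fun I => \sum_(v <- r | P v) c v * F v I)
  = \sum_(v <- r | P v) c v * cov S f (F v).
Proof.
rewrite /cov mean_sum mulr_sumr.
rewrite (@eq_mean _ _ (fun I => \sum_(v <- r | P v) c v * (f I * F v I))); last first.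
  by move=> I _; rewrite mulr_sumr; apply: eq_bigr => v _; rewrite mulrCA.
rewrite mean_sum -sumrB; apply: eq_bigr => v _.
by rewrite !meanZ; ring.
Qed.

Lemma var_subZ S f g c :
  var S (fun I => f I - c * g I)
  = var S f - 2 * c * cov S f g + c ^+ 2 * var S g.
Proof.
rewrite /var /cov meanB meanZ.
rewrite (@eq_mean _ (fun I => (_ - _) * _) (fun I => f I * f I
   + (- (2 * c) * (f I * g I) + c ^+ 2 * (g I * g I)))) => [|I _]; last by ring.
by rewrite !meanD !meanZ; ring.
Qed.

(** Let [h] be the combination of vertex indicators with coefficients
    [infl S v f].  The left-hand side is the covariance of [f] and [h]; since
    covariances of indicators are symmetric and proportional to influences,
    Schur's test bounds [var S h] by [kappa] times the same quantity, and the
    Cauchy-Schwarz inequality concludes. *)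
Lemma spectral_independence (g : V -> R) (kappa : R) S f :
  (forall w, 0 < g w) -> 0 < kappa ->
  (forall v, v \in S ->
     \sum_(w in S) `|infl S v (ind w)| * g w <= kappa * g v) ->
  \sum_(v in S) occ S v * (1 - occ S v) * infl S v f ^+ 2 <= kappa * var S f.
Proof.
move=> g0 k0 H; set d := fun v => infl S v f; set D := fun v => occ S v * (1 - occ S v).
set T := \sum_(v in S) _.
have D0 v : v \in S -> 0 <= D v.
  by move=> vS; rewrite mulr_ge0 ?(ltW (occ_gt0 S v)) // subr_ge0 ltW ?occ_lt1.
pose h := fun I => \sum_(v in S) d v * ind v I.
have covfh : cov S f h = T.
  by rewrite cov_sumr; apply: eq_bigr => v vS; rewrite cov_ind // /d; ring.
pose c v w := cov S (ind v) (ind w).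
have cE v w : v \in S -> c v w = D v * infl S v (ind w).
  by move=> vS; rewrite /c covC cov_ind.
have varh : var S h <= kappa * T.
  have -> : var S h = \sum_(v in S) \sum_(w in S) d v * d w * c v w.
    rewrite /var {2}/h cov_sumr; apply: eq_bigr => v vS.
    by rewrite covC cov_sumr mulr_sumr; apply: eq_bigr => w wS; rewrite mulrA.
  pose q v w := d v ^+ 2 * `|c v w| * (g w / g v) / 2.
  apply: (@le_trans _ _ (\sum_(v in S) \sum_(w in S) (q v w + q w v))).
    apply: ler_sum => v _; apply: ler_sum => w _.
    have -> : q w v = d w ^+ 2 * `|c v w| * (g v / g w) / 2 by rewrite /q /c covC.
    rewrite /q; apply: (@le_trans _ _ (`|d v| * `|d w| * `|c v w|)).
      by rewrite -!normrM ler_norm.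
    set x := g w / g v; have x0 : 0 < x by rewrite divr_gt0.
    have -> : g v / g w = x^-1 by rewrite /x invf_div.
    rewrite -subr_ge0.
    have -> : d v ^+ 2 * `|c v w| * x / 2 + d w ^+ 2 * `|c v w| * x^-1 / 2
        - `|d v| * `|d w| * `|c v w|
      = `|c v w| / (2 * x) * (`|d v| * x - `|d w|) ^+ 2.
      rewrite -[d v ^+ 2]real_normK ?num_real // -[d w ^+ 2]real_normK ?num_real //.
      by field; rewrite gt_eqF.
    by rewrite mulr_ge0 ?sqr_ge0 // divr_ge0 // mulr_ge0 // ltW.
  under eq_bigr do rewrite big_split /=.
  rewrite big_split /= [X in _ + X]exchange_big -mulr2n -mulr_natl mulr_sumr /T mulr_sumr.
  apply: ler_sum => v vS; rewrite mulr_sumr.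
  rewrite (eq_bigr (fun w => d v ^+ 2 * D v / g v * (`|infl S v (ind w)| * g w))); last first.
    move=> w wS; rewrite /q cE // normrM (ger0_norm (D0 v vS)).
    by field; rewrite gt_eqF.
  rewrite -mulr_sumr.
  apply: (@le_trans _ _ (d v ^+ 2 * D v / g v * (kappa * g v))).
    rewrite ler_wpM2l ?H //; apply: divr_ge0; last exact: ltW.
    by rewrite mulr_ge0 ?sqr_ge0 ?D0.
  by rewrite le_eqVlt; apply/orP; left; apply/eqP; rewrite /D /d; field; rewrite gt_eqF.
(* the Cauchy-Schwarz inequality, as nonnegativity of a variance *)
have := var_ge0 S (fun I => f I - kappa^-1 * h I); rewrite var_subZ covfh.
have H2 : kappa^-1 ^+ 2 * var S h <= kappa^-1 * T.
  apply: (@le_trans _ _ (kappa^-1 ^+ 2 * (kappa * T))).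
    by rewrite ler_wpM2l ?sqr_ge0.
  by rewrite expr2 -mulrA mulKf // gt_eqF.
move=> H3; have H4 : kappa^-1 * T <= var S f by lra.
by rewrite -ler_pdivrMl.
Qed.

Lemma mean_ind_bound S w : 0 <= mean S (ind w) <= lam / (1 + lam).
Proof.
have [wS|wS] := boolP (w \in S).
  by rewrite mean_ind // occ_le // ltW ?occ_gt0.
by rewrite mean_ind_notin // lexx divr_ge0 ?addr_ge0 ?(ltW lam_gt0).
Qed.

(** Every occupation probability lies between [0] and [lam / (1 + lam)], hence
    so does the modulus of every influence on another vertex. *)
Lemma infl_row_crude S v : v \in S ->
  \sum_(w in S) `|infl S v (ind w)| * 1 <= 1 + (#|S|.-1)%:R * (lam / (1 + lam)).
Proof.
move=> vS; rewrite (bigD1 v) //= infl_ind normr1 mulr1 lerD2l.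
have -> : (#|S|.-1)%:R * (lam / (1 + lam)) = \sum_(w in S | w != v) (lam / (1 + lam)).
  rewrite sumr_const mulr_natl; congr (_ *+ _).
  rewrite (cardsD1 v S) vS /=; apply: eq_card => w.
  by rewrite !finset.inE andbC.
apply: ler_sum => w /andP[_ wv]; rewrite mulr1 infl_ind_neq //.
have := mean_ind_bound (cond1 S v) w; have := mean_ind_bound (cond0 S v) w.
by move=> /andP[? ?] /andP[? ?]; rewrite ler_norml; apply/andP; split; lra.
Qed.

(** * Poincare inequality *)

(** The Dirichlet form of the dynamics on [S], up to the factor
    [lam / (1 + lam) / partition S]. *)
Definition energy_at S u f : R :=
  wsum (cond1 S u) (fun I => (add u f I - f I) ^+ 2).

Definition energy S f : R := \sum_(u in S) energy_at S u f.

Lemma energy_at_ge0 S u f : 0 <= energy_at S u f.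
Proof. by apply: wsum_ge0 => I _; rewrite sqr_ge0. Qed.

Lemma energy_ge0 S f : 0 <= energy S f.
Proof. by apply: sumr_ge0 => u _; apply: energy_at_ge0. Qed.

Lemma energy_at_split S u v f : u \in S -> v \in S -> u != v ->
  energy_at S u f = energy_at (cond0 S v) u f
    + lam * ((u \in cond1 S v)%:R * energy_at (cond1 S v) u (add v f)).
Proof.
move=> uS vS uv; rewrite /energy_at.
have E0 : cond0 (cond1 S u) v = cond1 (cond0 S v) u.
  by apply/finset.setP => x; rewrite !finset.inE; case: (e u x); case: (x == v); case: (x == u).
have [evu|nevu] := boolP (e v u).
  have -> : (u \in cond1 S v) = false by rewrite !finset.inE evu.
  rewrite mul0r mulr0 addr0 -E0 /cond0; congr (wsum _ _).
  apply/finset.setP => x; rewrite !finset.inE; case: (x =P v) => //= ->.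
  by rewrite e_sym evu.
have vu : v \in cond1 S u by rewrite !finset.inE e_sym nevu eq_sym uv.
rewrite (wsum_split _ vu) E0; congr (_ + _ * _).
have -> : u \in cond1 S v by rewrite !finset.inE nevu uv uS.
rewrite mul1r.
have -> : cond1 (cond1 S u) v = cond1 (cond1 S v) u.
  by apply/finset.setP => x; rewrite !finset.inE; case: (e v x); case: (e u x);
     rewrite /= ?andbF //; case: (x == u); case: (x == v).
by apply: eq_wsum => I _; rewrite /add [u |: _]finset.setUCA.
Qed.

(** Conditioning on the spin of [v] removes the term of [v] from the energy and,
    on average, keeps the others. *)
Lemma energy_split S f : \sum_(v in S) (energy (cond0 S v) f
    + lam * energy (cond1 S v) (add v f)) = (#|S|.-1)%:R * energy S f.
Proof.
transitivity (\sum_(v in S) \sum_(u in S | u != v) energy_at S u f).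
  apply: eq_bigr => v vS.
  rewrite [RHS](eq_bigr (fun u => energy_at (cond0 S v) u f
    + lam * ((u \in cond1 S v)%:R * energy_at (cond1 S v) u (add v f)))); last first.
    by move=> u /andP[uS uv]; rewrite (energy_at_split _ uS vS uv).
  rewrite big_split /= -mulr_sumr; congr (_ + _ * _).
    by apply: eq_bigl => u; rewrite !finset.inE andbC.
  rewrite /energy big_mkcond [RHS]big_mkcond /=.
  apply: eq_bigr => u _; case: (boolP (u \in cond1 S v)) => uc.
    by move: uc; rewrite !finset.inE => /and3P[_ -> ->]; rewrite mul1r.
  by case: ifP => _; rewrite ?mul0r.
rewrite (exchange_big_dep (mem S)) /=; last by move=> v u _ /andP[].
rewrite /energy mulr_sumr; apply: eq_bigr => u uS.
rewrite sumr_const mulr_natl; congr (_ *+ _).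
rewrite (cardsD1 u S) uS /=; apply: eq_card => w.
by rewrite finset.in_setD1 [w == u]eq_sym andbC.
Qed.

(** Without the normalization, [uvar_split] has no conditional probabilities. *)
Definition uvar S f : R := partition S * var S f.

Lemma uvar_split S v f : v \in S ->
  uvar S f = uvar (cond0 S v) f + lam * uvar (cond1 S v) (add v f)
    + partition S * (occ S v * (1 - occ S v) * infl S v f ^+ 2).
Proof.
move=> vS; rewrite /uvar /var (cov_split _ _ vS) occ_compl // /occ.
by field; rewrite partition_neq0.
Qed.

Lemma mean_set0 f : mean finset.set0 f = f finset.set0.
Proof.
rewrite (@eq_mean _ _ (fun=> f finset.set0)) ?mean_const // => I.
by rewrite finset.subset0 => /eqP ->.
Qed.

Lemma partition_set0 : partition finset.set0 = 1.
Proof.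
rewrite /partition /wsum (big_pred1 finset.set0) ?weight0 ?mulr1 // => I.
by rewrite finset.subset0.
Qed.

Lemma var_set0 f : var finset.set0 f = 0.
Proof. by rewrite /var /cov !mean_set0 subrr. Qed.

Lemma poincare_single S f : #|S| = 1%N ->
  uvar S f = lam / (1 + lam) * energy S f.
Proof.
move=> /eqP/cards1P[v ->]; have vS : v \in [set v] by rewrite finset.inE.
have c0 : cond0 [set v] v = finset.set0.
  by apply/finset.setP => x; rewrite !finset.inE; case: (x == v).
have c1 : cond1 [set v] v = finset.set0.
  by apply/eqP; rewrite -finset.subset0 -c0 cond1_cond0.
have zv : partition [set v] = 1 + lam.
  by rewrite (partition_split vS) c0 c1 partition_set0 mulr1.
rewrite (uvar_split _ vS) /uvar c0 c1 !var_set0 !mulr0 !addr0 add0r.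
rewrite /energy big_set1 /energy_at c1 wsum_mean partition_set0 mul1r /infl c0 c1 !mean_set0.
rewrite occ_compl // /occ c0 c1 partition_set0 zv; field.
by rewrite gt_eqF // addr_gt0.
Qed.

(** Revealing a uniformly random vertex of [S] keeps, on average, all but a
    fraction [(1 + eta) / #|S|] of the variance, so iterating over the sizes
    costs a product of order [#|S| ^ O(eta)].  When [#|S|] is of the order of
    [eta] this bound degenerates, and the crude bound on influences takes
    over. *)
Lemma poincare (g : V -> R) (eta : R) S f :
  (forall w, 0 < g w) -> 0 <= eta -> lam <= 9 ->
  (forall S v, v \in S -> abs_infl S g v <= (1 + eta) * g v) ->
  uvar S f <= #|S|%:R `^ (20 * eta) * (lam / (1 + lam) * energy S f).
Proof.
move=> g0 eta0 lam9 Hinfl; set c := lam / (1 + lam).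
have c0 : 0 <= c by rewrite divr_ge0 ?addr_ge0 ?(ltW lam_gt0).
have E0 T h : 0 <= c * energy T h by exact: mulr_ge0 c0 (energy_ge0 T h).
have := leqnn #|S|; move: {2}#|S| => m.
elim: m S f => [|m IH] S f Sm.
  move: Sm; rewrite leqn0 cards_eq0 => /eqP ->.
  rewrite /uvar var_set0 mulr0 mulr_ge0 ?powR_ge0 //.
move: Sm; rewrite leq_eqVlt ltnS => /orP[/eqP Sm|]; last exact: IH.
case: m IH Sm => [|m] IH Sm.
  by rewrite poincare_single // Sm powR1 mul1r.
set j := m.+1 in IH Sm *.
set Phi := j%:R `^ (20 * eta) : R; have Phi0 : 0 <= Phi by exact: powR_ge0.
set B := Phi * (c * energy S f).
have B0 : 0 <= B by rewrite mulr_ge0.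
have IHphi (T : {set V}) h : (#|T| <= j)%N -> uvar T h <= Phi * (c * energy T h).
  move=> Tj; apply: (le_trans (IH T h Tj)).
  rewrite ler_wpM2r // ge0_ler_powR ?nnegrE // ?mulr_ge0 //.
  by rewrite ler_nat.
have cardc0 v : v \in S -> (#|cond0 S v| <= j)%N.
  by move=> vS; move: Sm; rewrite (cardsD1 v S) vS => -[<-].
have cardc1 v : v \in S -> (#|cond1 S v| <= j)%N.
  by move=> /cardc0; apply: leq_trans; apply: subset_leq_card; exact: cond1_cond0.
set X := \sum_(v in S) occ S v * (1 - occ S v) * infl S v f ^+ 2.
have sumv : j.+1%:R * uvar S f <= j%:R * B + partition S * X.
  have -> : j.+1%:R * uvar S f = \sum_(v in S) uvar S f.
    by rewrite sumr_const Sm mulr_natl.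
  have -> : j%:R * B = Phi * c * \sum_(v in S) (energy (cond0 S v) f
      + lam * energy (cond1 S v) (add v f)).
    by rewrite energy_split Sm /= /B; ring.
  rewrite !mulr_sumr -big_split /=; apply: ler_sum => v vS.
  rewrite (uvar_split _ vS) lerD2r mulrDr; apply: lerD.
    by rewrite -mulrA IHphi ?cardc0.
  by rewrite [leRHS]mulrCA ler_wpM2l ?(ltW lam_gt0) // -mulrA IHphi ?cardc1.
have level kappa (h : V -> R) : (forall w, 0 < h w) -> 0 < kappa ->
    (forall v, v \in S -> \sum_(w in S) `|infl S v (ind w)| * h w <= kappa * h v) ->
    (j.+1%:R - kappa) * uvar S f <= j%:R * B.
  move=> h0 k0 H; have := spectral_independence f h0 k0 H; rewrite -/X => HX.
  have : partition S * X <= kappa * uvar S f.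
    by rewrite /uvar mulrCA ler_wpM2l // ltW.
  by lra.
have L1 : (j%:R - eta) * uvar S f <= j%:R * B.
  have -> : j%:R - eta = j.+1%:R - (1 + eta) :> R by rewrite -natr1; ring.
  apply: (level _ g) => //; first by rewrite ltr_wpDr.
  move=> v vS; apply: le_trans (Hinfl S v vS).
  rewrite /abs_infl [leRHS](bigID (mem S)) /= lerDl.
  by apply: sumr_ge0 => w _; rewrite mulr_ge0 // ltW.
have J0 : 0 < j%:R :> R by rewrite ltr0n.
have L2 : uvar S f <= 10 * B.
  have L : (j.+1%:R - (1 + j%:R * c)) * uvar S f <= j%:R * B.
    apply: (level _ (fun=> 1)) => //; first by rewrite ltr_wpDr // mulr_ge0 // ltW.
    by move=> v vS; rewrite mulr1; have := infl_row_crude vS; rewrite Sm.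
  have l1 : 0 < 1 + lam by rewrite addr_gt0.
  have E : j.+1%:R - (1 + j%:R * c) = j%:R * (1 + lam)^-1.
    by rewrite -natr1 /c; field; rewrite gt_eqF.
  move: L; rewrite E -mulrA ler_pM2l // mulrC ler_pdivrMr // => L.
  by apply: (le_trans L); rewrite mulrC ler_wpM2r //; lra.
apply: le_trans (growth_step _ eta0 B0 L1 L2) _ => //.
rewrite Sm /B mulrA ler_wpM2r //.
exact: powR_growth.
Qed.

(** * The Glauber dynamics as an operator *)

(** If a neighbour of [v] is occupied then an independent [I] does not contain
    [v], so [I :\ v] is [I]; with this form [update] is well behaved on sets
    that are not independent too. *)
Definition update v f I : R :=
  if I \subset ~: nbrs v then (f (I :\ v) + lam * f (v |: I)) / (1 + lam)
  else f (I :\ v).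

Definition step f I : R := #|V|%:R^-1 * \sum_v update v f I.

Lemma lam1_gt0 : 0 < 1 + lam.
Proof. by rewrite addr_gt0. Qed.

Lemma wsum_update v f (phi : R -> R) :
  wsum finset.setT (fun I => phi (f I)) - wsum finset.setT (fun I => phi (update v f I))
  = wsum (cond1 finset.setT v) (fun I => phi (f I) + lam * phi (f (v |: I))
      - (1 + lam) * phi ((f I + lam * f (v |: I)) / (1 + lam))).
Proof.
have vT : v \in [set: V] by rewrite finset.inE.
have sp F : wsum finset.setT F = \sum_(I : {set V} | (I \subset cond0 finset.setT v)
      && ~~ (I \subset ~: nbrs v)) weight I * F I
    + wsum (cond1 finset.setT v) (fun I => F I + lam * F (v |: I)).
  rewrite (wsum_split _ vT) wsumD wsumZ addrA; congr (_ + _).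
  rewrite {1}/wsum (bigID (fun I => I \subset ~: nbrs v)) /= addrC; congr (_ + _).
  by apply: eq_bigl => I; rewrite sub_cond1.
rewrite !sp.
have -> : \sum_(I : {set V} | (I \subset cond0 finset.setT v)
      && ~~ (I \subset ~: nbrs v)) weight I * phi (update v f I)
  = \sum_(I : {set V} | (I \subset cond0 finset.setT v)
      && ~~ (I \subset ~: nbrs v)) weight I * phi (f I).
  apply: eq_bigr => I /andP[/notin_cond0 vI /negbTE IN].
  rewrite /update IN finset.setDE (finset.setIidPl _) //.
  by rewrite finset.subsetC finset.sub1set finset.inE.
rewrite opprD addrACA subrr add0r -wsumB; apply: eq_wsum => I IS; congr (_ - _).
have vI := notin_cond1 IS; move: IS; rewrite sub_cond1 => /andP[_ IN].
have vIN : v |: I \subset ~: nbrs v.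
  by rewrite finset.subUset IN andbT finset.sub1set !finset.inE e_irr.
have Iv : I :\ v = I.
  by rewrite finset.setDE (finset.setIidPl _) // finset.subsetC finset.sub1set finset.inE.
by rewrite /update IN vIN Iv finset.setU1K // finset.setUA finset.setUid; ring.
Qed.

Lemma mean_update v f : mean finset.setT (update v f) = mean finset.setT f.
Proof.
congr (_ / _); apply/eqP; rewrite eq_sym -subr_eq0; apply/eqP.
rewrite (wsum_update v f id) (@eq_wsum _ _ (fun=> 0)) => [|I _].
  by rewrite wsum_const mul0r.
by field; rewrite gt_eqF ?lam1_gt0.
Qed.

Lemma mean_update_sqr v f :
  mean finset.setT (fun I => update v f I ^+ 2)
  = mean finset.setT (fun I => f I ^+ 2)
    - lam / (1 + lam) * energy_at finset.setT v f / partition finset.setT.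
Proof.
rewrite /mean -mulrBl; congr (_ / _); apply/eqP; rewrite eq_sym subr_eq addrC -subr_eq.
apply/eqP; rewrite (wsum_update v f (fun x => x ^+ 2)) /energy_at -wsumZ.
apply: eq_wsum => I _; rewrite /add; field; by rewrite gt_eqF ?lam1_gt0.
Qed.

Hypothesis V_gt0 : (0 < #|V|)%N.

Let n_gt0 : 0 < #|V|%:R :> R. Proof. by rewrite ltr0n. Qed.

Lemma sum_const (c : R) : \sum_(v : V) c = #|V|%:R * c.
Proof. by rewrite sumr_const mulr_natl. Qed.

Lemma mean_step f : mean finset.setT (step f) = mean finset.setT f.
Proof.
rewrite /step meanZ mean_sum (eq_bigr (fun=> mean finset.setT f)) => [|v _].
  by rewrite sum_const mulKf // gt_eqF.
exact: mean_update.
Qed.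

Lemma sqr_average (F : V -> R) :
  (#|V|%:R^-1 * \sum_v F v) ^+ 2 <= #|V|%:R^-1 * \sum_v F v ^+ 2.
Proof.
set m := _ * _; rewrite -subr_ge0.
have -> : #|V|%:R^-1 * \sum_v F v ^+ 2 - m ^+ 2 = #|V|%:R^-1 * \sum_v (F v - m) ^+ 2.
  rewrite [in RHS](eq_bigr (fun v => F v ^+ 2 + (- (2 * m) * F v + m ^+ 2))); last first.
    by move=> v _; ring.
  rewrite !big_split /= sum_const -mulr_sumr !mulrDr.
  have -> : \sum_v F v = #|V|%:R * m by rewrite /m mulVKf // gt_eqF.
  by field; rewrite gt_eqF.
by rewrite mulr_ge0 ?invr_ge0 ?(ltW n_gt0) // sumr_ge0 // => v _; rewrite sqr_ge0.
Qed.

(** Each single-site update is a conditional expectation, so it removes the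
    local variance at its site; by convexity of the square, the average over
    the sites removes at least the average of these local variances. *)
Lemma var_step f : var finset.setT (step f) <= var finset.setT f
  - #|V|%:R^-1 * (lam / (1 + lam) * energy finset.setT f / partition finset.setT).
Proof.
rewrite /var /cov mean_step [leRHS]addrAC lerD2r.
apply: (@le_trans _ _ (mean finset.setT (fun I => #|V|%:R^-1 * \sum_v update v f I ^+ 2))).
  by apply: le_mean => I _; rewrite -expr2; exact: sqr_average.
rewrite meanZ mean_sum.
rewrite (eq_bigr (fun v => mean finset.setT (fun I => f I ^+ 2)
   - lam / (1 + lam) * energy_at finset.setT v f / partition finset.setT)); last first.
  by move=> v _; exact: mean_update_sqr.
rewrite sumrB sum_const mulrBr mulKf ?gt_eqF // lerD2l lerN2.
rewrite ler_wpM2l ?invr_ge0 ?(ltW n_gt0) //.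
rewrite /energy -mulr_suml -mulr_sumr le_eqVlt; apply/orP; left; apply/eqP.
by congr (_ * _ / _); apply: eq_bigl => v; rewrite finset.inE.
Qed.

Lemma step_contracts (Phi : R) f : 1 <= Phi ->
  (forall h, uvar finset.setT h <= Phi * (lam / (1 + lam) * energy finset.setT h)) ->
  forall t, var finset.setT (iter t step f)
    <= (1 - (#|V|%:R * Phi)^-1) ^+ t * var finset.setT f.
Proof.
move=> Phi1 H; set r := 1 - _; have Phi0 : 0 < Phi by exact: lt_le_trans Phi1.
have one h : var finset.setT (step h) <= r * var finset.setT h.
  apply: (le_trans (var_step h)); rewrite /r mulrBl mul1r lerD2l lerN2 invfM.
  rewrite -[_ * var _ _]mulrA.
  by rewrite ler_pM2l ?invr_gt0 // ler_pdivrMl // mulrA ler_pdivlMr // mulrC H.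
have r0 : 0 <= r.
  rewrite subr_ge0 invf_le1 ?mulr_gt0 //.
  have n1 : 1 <= #|V|%:R :> R by rewrite ler1n.
  by have := ler_pM ler01 ler01 n1 Phi1; rewrite mulr1.
elim=> [|t IH] /=; first by rewrite expr0 mul1r.
by apply: (le_trans (one _)); rewrite exprS -mulrA ler_wpM2l.
Qed.

Lemma update_mono v f g : (forall I, f I <= g I) -> forall I, update v f I <= update v g I.
Proof.
move=> fg I; rewrite /update; case: ifP => // _.
by rewrite ler_pM2r ?invr_gt0 ?lam1_gt0 // lerD ?ler_wpM2l ?(ltW lam_gt0).
Qed.

Lemma step_mono f g : (forall I, f I <= g I) -> forall I, step f I <= step g I.
Proof.
move=> fg I; rewrite ler_wpM2l ?invr_ge0 ?(ltW n_gt0) //.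
by apply: ler_sum => v _; exact: update_mono.
Qed.

Lemma step_affine f (c d : R) I : step (fun J => c * f J + d) I = c * step f I + d.
Proof.
rewrite /step (eq_bigr (fun v => c * update v f I + d)) => [|v _].
  by rewrite big_split /= sum_const -mulr_sumr mulrDr mulKf ?gt_eqF // mulrCA.
by rewrite /update; case: ifP => // _; field; rewrite gt_eqF ?lam1_gt0.
Qed.

Lemma eq_step f g : (forall I, f I = g I) -> forall I, step f I = step g I.
Proof. by move=> fg I; apply/eqP; rewrite eq_le !step_mono // => J; rewrite fg. Qed.

Lemma iter_step_mono t f g : (forall I, f I <= g I) ->
  forall I, iter t step f I <= iter t step g I.
Proof. by move=> fg; elim: t => [|t IH] //= I; exact: step_mono. Qed.

Lemma iter_step_affine t f (c d : R) I :
  iter t step (fun J => c * f J + d) I = c * iter t step f I + d.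
Proof.
elim: t I => [|t IH] // I; rewrite !iterS -step_affine.
by apply: eq_step => J.
Qed.

Definition size_of I : R := #|I|%:R.

Lemma size_ofE I : size_of I = \sum_v ind v I.
Proof.
rewrite /size_of /ind -sum1_card natr_sum big_mkcond.
by apply: eq_bigr => v _; case: (v \in I).
Qed.

(** The chosen vertex is emptied and then filled with probability at most [lam]. *)
Lemma step_size I : step size_of I <= (1 - #|V|%:R^-1) * size_of I + lam.
Proof.
have up v : update v size_of I <= size_of I - (v \in I)%:R + lam.
  rewrite /update /size_of; have cE : #|I|%:R - (v \in I)%:R = #|I :\ v|%:R :> R.
    by rewrite (cardsD1 v I) natrD; ring.
  rewrite cE; case: ifP => _; last by rewrite lerDl ltW.
  rewrite ler_pdivrMr ?lam1_gt0 //.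
  have -> : #|v |: I|%:R = 1 + #|I :\ v|%:R :> R.
    have -> : v |: I = v |: (I :\ v).
      by apply/finset.setP => w; rewrite !finset.inE; case: (w == v).
    by rewrite finset.cardsU1 !finset.inE eqxx natrD.
  have := ler0n R #|I :\ v|; have := lam_gt0; nra.
rewrite /step; apply: (@le_trans _ _ (#|V|%:R^-1 * \sum_v (size_of I - (v \in I)%:R + lam))).
  by rewrite ler_wpM2l ?invr_ge0 ?(ltW n_gt0) // ler_sum.
rewrite !big_split /= !sum_const sumrN.
rewrite -size_ofE.
by rewrite le_eqVlt; apply/orP; left; apply/eqP; field; rewrite gt_eqF.
Qed.

Lemma iter_step_size t I :
  iter t step size_of I <= (1 - #|V|%:R^-1) ^+ t * size_of I + lam * #|V|%:R.
Proof.
elim: t => [|t IH]; first by rewrite expr0 mul1r lerDl mulr_ge0 ?(ltW lam_gt0).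
rewrite iterSr; apply: (le_trans (iter_step_mono t step_size I)).
rewrite iter_step_affine exprS -mulrA.
have r0 : 0 <= 1 - #|V|%:R^-1 :> R by rewrite subr_ge0 invf_le1 // ler1n.
have := ler_wpM2l r0 IH; rewrite mulrDr => H; apply: (le_trans (lerD H (lexx lam))).
rewrite -addrA lerD2l le_eqVlt; apply/orP; left; apply/eqP.
by field; rewrite gt_eqF.
Qed.

Lemma mean_size : mean finset.setT size_of <= lam * #|V|%:R.
Proof.
rewrite (@eq_mean _ _ (fun I => \sum_v ind v I)) => [|I _]; last first.
  exact: size_ofE.
rewrite mean_sum mulrC -sum_const; apply: ler_sum => v _.
by rewrite mean_ind ?occ_le_lam // finset.inE.
Qed.

(** * From spin configurations to vertex sets *)

Implicit Types (s t x y : config V).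

Definition occupied s : {set V} := [set v | s v].
Definition config_of I : config V := [ffun v => v \in I].
Definition set_spin s v (b : bool) : config V := [ffun w => if w == v then b else s w].

Lemma occupiedK : cancel occupied config_of.
Proof. by move=> s; apply/ffunP => v; rewrite ffunE finset.inE. Qed.

Lemma config_ofK : cancel config_of occupied.
Proof. by move=> I; apply/finset.setP => v; rewrite finset.inE ffunE. Qed.

Lemma occupied_false s v : occupied (set_spin s v false) = occupied s :\ v.
Proof. by apply/finset.setP => w; rewrite !finset.inE ffunE; case: (w == v). Qed.

Lemma occupied_true s v : occupied (set_spin s v true) = v |: occupied s.
Proof. by apply/finset.setP => w; rewrite !finset.inE ffunE; case: (w == v). Qed.

Lemma set_spin_at s v b : set_spin s v b v = b.
Proof. by rewrite ffunE eqxx. Qed.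

Lemma hc_weightE s : hc_weight e lam s = weight (occupied s).
Proof.
rewrite /hc_weight /weight.
have -> : independent e s = indep_set (occupied s).
  apply/idP/idP.
    move=> /forallP H; apply/forall_inP => u; rewrite finset.inE => su.
    apply/forall_inP => w; rewrite finset.inE => sw.
    by apply/negP => euw; have /forallP/(_ w) := H u; rewrite euw su sw.
  move=> /forall_inP H; apply/forallP => u; apply/forallP => w; apply/implyP => euw.
  apply/negP => /andP[su sw].
  have /forall_inP/(_ w) : [forall w in occupied s, ~~ e u w] by apply: H; rewrite finset.inE.
  by rewrite finset.inE euw => /(_ sw).
have -> : #|[pred v | s v]| = #|occupied s| by apply: eq_card => v; rewrite finset.in_set.
by case: ifP => _; rewrite ?mul1r ?mul0r.
Qed.

Lemma sum_config (F : {set V} -> R) : \sum_s F (occupied s) = \sum_(I : {set V}) F I.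
Proof.
by rewrite [RHS](reindex occupied) //; exists config_of => s _; rewrite ?occupiedK ?config_ofK.
Qed.

Lemma wsum_setT f : wsum finset.setT f = \sum_(I : {set V}) weight I * f I.
Proof. by apply: eq_bigl => I; rewrite finset.subsetT. Qed.

Let mu := hard_core e lam.

Lemma muE s : mu s = weight (occupied s) / partition finset.setT.
Proof.
rewrite /mu /hard_core hc_weightE; congr (_ / _).
rewrite (eq_bigr (fun t => weight (occupied t))) => [|t _]; last exact: hc_weightE.
rewrite sum_config /partition wsum_setT; by apply: eq_bigr => I _; rewrite mulr1.
Qed.

Lemma mu_neq0 s : (mu s != 0) = (weight (occupied s) != 0).
Proof. by rewrite muE mulf_eq0 invr_eq0 (negbTE (partition_neq0 _)) orbF. Qed.

Lemma mu_ge0 s : 0 <= mu s.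
Proof. by rewrite muE divr_ge0 ?weight_ge0 // ltW. Qed.

Lemma sum_mu f : \sum_s mu s * f (occupied s) = mean finset.setT f.
Proof.
rewrite /mean wsum_setT -sum_config mulr_suml; apply: eq_bigr => s _.
by rewrite muE mulrAC.
Qed.

Lemma weight_neq0 I : (weight I != 0) = indep_set I.
Proof.
rewrite /weight mulf_eq0 negb_or (expf_neq0 _ (lt0r_neq0 lam_gt0)) andbT pnatr_eq0.
by case: (indep_set I).
Qed.

Lemma weight_del v I : weight I != 0 -> weight (I :\ v) != 0.
Proof.
rewrite !weight_neq0.
move=> /forall_inP H; apply/forall_inP => u; rewrite !finset.inE => /andP[_ uI].
apply/forall_inP => w; rewrite !finset.inE => /andP[_ wI].
by have /forall_inP/(_ w wI) := H u uI.
Qed.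

Lemma weight_conflict v I : v \in I -> ~~ (I \subset ~: nbrs v) -> weight I = 0.
Proof.
move=> vI IN; rewrite -(finset.setD1K vI) weight_add ?finset.inE ?eqxx //.
case: ifP => // H; case/negP: IN; rewrite -(finset.setD1K vI) finset.subUset H andbT.
by rewrite finset.sub1set !finset.inE e_irr.
Qed.

Lemma agree_nbrs s t v : agree_on (e v) t s ->
  (occupied t \subset ~: nbrs v) = (occupied s \subset ~: nbrs v).
Proof.
move=> /forallP H.
have imp (a b : config V) : (forall w, e v w -> a w = b w) ->
    occupied a \subset ~: nbrs v -> occupied b \subset ~: nbrs v.
  move=> ab /fintype.subsetP K; apply/fintype.subsetP => w.
  rewrite !finset.inE => bw; apply/negP => evw.
  by have := K w; rewrite !finset.inE ab // bw evw => /(_ isT).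
by apply/idP/idP; apply: imp => w evw; have := H w; rewrite evw => /eqP.
Qed.

Lemma agree_set_spin s t v b : agree_on (e v) (set_spin t v b) s = agree_on (e v) t s.
Proof.
apply: eq_forallb => w; rewrite ffunE; case: (w =P v) => // ->.
by rewrite e_irr.
Qed.

(** Occupying [v] maps the configurations with [v] empty that agree with [s] near
    [v] bijectively onto those with [v] occupied, and multiplies the weights by
    [lam], or by [0] if [s] occupies a neighbour of [v]. *)
Lemma cond_marginalE v s b : mu s != 0 ->
  cond_marginal e mu v s b =
    if occupied s \subset ~: nbrs v then (if b then lam else 1) / (1 + lam)
    else (~~ b)%:R.
Proof.
move=> s0; rewrite /cond_marginal.
set a := fun b => \sum_(t | agree_on (e v) t s && (t v == b)) mu t.
have -> : \sum_(t | agree_on (e v) t s) mu t = a false + a true.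
  rewrite (bigID (fun t : config V => t v == false)) /=; congr (_ + _).
  by apply: eq_bigl => t; case: (t v); rewrite ?andbF ?andbT.
have a0 : 0 < a false.
  rewrite /a (bigD1 (set_spin s v false)) /=; last first.
    rewrite agree_set_spin set_spin_at eqxx andbT.
    by apply/forallP => w; rewrite eqxx implybT.
  rewrite ltr_pwDl //; last by apply: sumr_ge0 => t _; exact: mu_ge0.
  rewrite lt_neqAle mu_ge0 andbT eq_sym mu_neq0 occupied_false weight_del //.
  by rewrite -mu_neq0.
have a1 : a true = if occupied s \subset ~: nbrs v then lam * a false else 0.
  case: ifPn => sN; last first.
    rewrite /a big1 // => t /andP[/agree_nbrs ts /eqP tv].
    by rewrite muE (@weight_conflict v) ?mul0r ?ts // finset.inE.
  rewrite /a (reindex_onto (fun t => set_spin t v true)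
    (fun t => set_spin t v false)) /=; last first.
    move=> t /andP[_ /eqP tv]; apply/ffunP => w; rewrite !ffunE.
    by case: eqP => // ->.
  rewrite mulr_sumr; apply: eq_big => [t|t].
    rewrite agree_set_spin set_spin_at eqxx andbT; congr (_ && _).
    apply/eqP/eqP => [<-|tv]; first by rewrite set_spin_at.
    by apply/ffunP => w; rewrite !ffunE; case: eqP => // ->.
  rewrite agree_set_spin => /andP[/andP[ts _] /eqP tE].
  rewrite !muE occupied_true weight_add ?(agree_nbrs ts) ?sN ?mulrA //.
  by rewrite finset.inE -tE set_spin_at.
case: ifPn a1 => sN a1; case: b => /=.
- rewrite -/(a true) a1; have -> : a false + lam * a false = (1 + lam) * a false by ring.
  by field; rewrite !gt_eqF ?lam1_gt0.
- rewrite -/(a false) a1; have -> : a false + lam * a false = (1 + lam) * a false by ring.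
  by field; rewrite !gt_eqF ?lam1_gt0.
- by rewrite -/(a true) a1 mul0r.
- by rewrite -/(a false) a1 addr0 divff ?gt_eqF.
Qed.

Lemma agree_off s t v : agree_on (predC1 v) t s -> t = set_spin s v (t v).
Proof.
move=> /forallP H; apply/ffunP => w; rewrite ffunE; case: (w =P v) => [->//|/eqP wv].
by have := H w; rewrite /= wv /= => /eqP.
Qed.

Lemma glauberE x f : mu x != 0 ->
  \sum_(y | mu y != 0) glauber e mu x y * f (occupied y) = step f (occupied x).
Proof.
move=> x0.
rewrite (eq_bigr (fun y => #|V|%:R^-1 * \sum_v (if agree_on (predC1 v) y x
   then cond_marginal e mu v y (y v) * f (occupied y) else 0))); last first.
  move=> y _; rewrite /glauber -mulrA; congr (_ * _).
  by rewrite mulr_suml [LHS]big_mkcond.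
rewrite -mulr_sumr exchange_big /step; congr (_ * _); apply: eq_bigr => v _.
rewrite -big_mkcondr /=.
rewrite (reindex_onto (set_spin x v) (fun y => y v)) /=; last first.
  by move=> y /andP[_ /agree_off <-].
have agr b : agree_on (predC1 v) (set_spin x v b) x.
  by apply/forallP => w; rewrite ffunE /=; case: (w == v); rewrite ?eqxx.
rewrite (eq_bigl (fun b => mu (set_spin x v b) != 0)); last first.
  by move=> b; rewrite agr set_spin_at eqxx !andbT.
rewrite big_mkcond big_bool /=.
have x0' : weight (occupied x) != 0 by rewrite -mu_neq0.
have f0 : mu (set_spin x v false) != 0 by rewrite mu_neq0 occupied_false weight_del.
have vD : v \notin occupied x :\ v by rewrite !finset.inE eqxx.
have NE : (occupied x :\ v \subset ~: nbrs v) = (occupied x \subset ~: nbrs v).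
  apply/fintype.subsetP/fintype.subsetP => H w; last first.
    by rewrite finset.in_setD1 => /andP[_ /H].
  case: (w =P v) => [-> _|/eqP wv wx]; first by rewrite !finset.inE e_irr.
  by apply: H; rewrite finset.in_setD1 wv.
have UE : v |: occupied x = v |: (occupied x :\ v).
  by apply/finset.setP => w; rewrite !finset.inE; case: (w == v).
have t0 : (mu (set_spin x v true) != 0) = (occupied x \subset ~: nbrs v).
  rewrite mu_neq0 occupied_true UE weight_add // NE; case: ifP => // _; last by rewrite eqxx.
  by rewrite mulf_neq0 ?(lt0r_neq0 lam_gt0) // weight_del.
rewrite t0 (cond_marginalE _ _ f0) f0 !set_spin_at occupied_false occupied_true NE /update.
case: ifPn => xN /=; last by rewrite mul1r add0r.
rewrite cond_marginalE ?t0 // occupied_true.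
have -> : v |: occupied x \subset ~: nbrs v.
  by rewrite finset.subUset xN andbT finset.sub1set !finset.inE e_irr.
by rewrite mulrDl addrC; congr (_ + _); rewrite ?mulrA mulrAC ?mul1r // mulrC.
Qed.

(** The mean of [f] under the law at time [k], started at [x], is the value at
    [x] of the transition operator applied [k] times to [f]. *)
Lemma kernel_powE k x f : mu x != 0 ->
  \sum_(y | mu y != 0) kernel_pow mu (glauber e mu) k x y * f (occupied y)
  = iter k step f (occupied x).
Proof.
move=> x0; elim: k f => [|k IH] f.
  rewrite (bigD1 x) //= eqxx mul1r big1 ?addr0 // => y /andP[_ /negbTE yx].
  by rewrite eq_sym yx mul0r.
rewrite iterSr -IH /=.
transitivity (\sum_(y | mu y != 0) \sum_(z | mu z != 0)
   kernel_pow mu (glauber e mu) k x z * (glauber e mu z y * f (occupied y))).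
  by apply: eq_bigr => y _; rewrite mulr_suml; apply: eq_bigr => z _; rewrite mulrA.
rewrite exchange_big; apply: eq_bigr => z z0.
by rewrite -mulr_sumr glauberE.
Qed.

(** The sign of the difference of the two laws is an optimal test function. *)
Lemma tv_dist_test k x : mu x != 0 ->
  exists2 f : {set V} -> R, forall I, `|f I| <= 1 &
    tv_dist mu (kernel_pow mu (glauber e mu) k x) mu
      = 2^-1 * (iter k step f (occupied x) - mean finset.setT f).
Proof.
move=> x0; set nu := kernel_pow mu _ k x.
exists (fun I => Num.sg (nu (config_of I) - mu (config_of I))).
  by move=> I; rewrite normr_sg; case: (_ == 0); rewrite /= ?lexx ?ler01.
rewrite /tv_dist -kernel_powE // -sum_mu -/nu; congr (_ * _).
have -> (F : config V -> R) : \sum_y mu y * F y = \sum_(y | mu y != 0) mu y * F y.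
  by rewrite [RHS]big_mkcond; apply: eq_bigr => y _; case: eqP => //= ->; rewrite mul0r.
rewrite -sumrB; apply: eq_bigr => y _; rewrite occupiedK -mulrBl.
by rewrite normrEsg mulrC.
Qed.

(** * Distance to stationarity *)

Lemma exp_decay (a : R) (t : nat) : 0 <= a <= 1 -> (1 - a) ^+ t <= expR (- (t%:R * a)).
Proof.
move=> /andP[a0 a1]; rewrite -mulrN expRM_natl lerXn2r ?nnegrE ?subr_ge0 ?expR_ge0 //.
exact: expR_ge1Dx.
Qed.

Lemma point_le_var h I : weight I / partition finset.setT * (h I - mean finset.setT h) ^+ 2
  <= var finset.setT h.
Proof.
rewrite var_sqr; set m := mean finset.setT h.
rewrite /mean wsum_setT (bigD1 I) //= mulrDl mulrAC lerDl.
rewrite divr_ge0 ?(ltW (partition_gt0 _)) //; apply: sumr_ge0 => J _.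
by rewrite mulr_ge0 ?weight_ge0 ?sqr_ge0.
Qed.

(** The test function has variance at most [1], which decays geometrically, and
    a state of probability [mu x] deviates from the mean by at most the standard
    deviation divided by [Num.sqrt (mu x)]. *)
Lemma tv_of_contraction (Phi : R) k x : 1 <= Phi -> mu x != 0 ->
  (forall h, uvar finset.setT h <= Phi * (lam / (1 + lam) * energy finset.setT h)) ->
  expR (- (k%:R / (#|V|%:R * Phi))) <= mu x / 4 ->
  tv_dist mu (kernel_pow mu (glauber e mu) k x) mu <= 4^-1.
Proof.
move=> Phi1 x0 H Hk; have [f f1 ->] := tv_dist_test k x0.
set h := iter k step f.
have mh : mean finset.setT f = mean finset.setT h.
  by rewrite /h; elim: k {Hk h} => //= k ->; rewrite mean_step.
have mux : 0 < mu x by rewrite lt_neqAle mu_ge0 eq_sym x0.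
have Phi0 : 0 < Phi by exact: lt_le_trans Phi1.
have vf : var finset.setT f <= 1.
  rewrite /var /cov lerBlDr -[leLHS]addr0 lerD -?expr2 ?sqr_ge0 //.
  rewrite -[leRHS](mean_const finset.setT); apply: le_mean => I _.
  by rewrite -expr2 -real_normK ?num_real // expr_le1.
have nPhi : 1 <= #|V|%:R * Phi.
  have n1 : 1 <= #|V|%:R :> R by rewrite ler1n.
  by have := ler_pM ler01 ler01 n1 Phi1; rewrite mulr1.
have a01 : 0 <= (#|V|%:R * Phi)^-1 <= 1.
  by rewrite invr_ge0 invf_le1 ?(lt_le_trans ltr01 nPhi) // nPhi (le_trans ler01 nPhi).
have r0 : 0 <= (1 - (#|V|%:R * Phi)^-1) ^+ k.
  by rewrite exprn_ge0 // subr_ge0; case/andP: a01.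
have vh : var finset.setT h <= mu x / 4.
  apply: (le_trans (step_contracts f Phi1 H k)).
  apply: le_trans Hk; apply: le_trans (exp_decay k a01).
  by rewrite ler_piMr.
have := le_trans (point_le_var h (occupied x)) vh.
rewrite -muE ler_pM2l // mh; set d := _ - _ => d2.
have : `|d| <= 2^-1.
  rewrite -ler_sqr ?nnegrE ?invr_ge0 // real_normK ?num_real // (le_trans d2) //.
  by lra.
rewrite ler_norml => /andP[_ ?]; lra.
Qed.

(** At very small fugacity the empty set carries almost all the mass and every
    occupied vertex most likely disappears at its next update; a test function
    differs from its value at the empty set by at most twice the number of
    occupied vertices. *)
Lemma tv_of_small_fugacity k x : mu x != 0 ->
  lam * #|V|%:R <= 16^-1 -> (1 - #|V|%:R^-1) ^+ k * #|V|%:R <= 16^-1 :> R ->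
  tv_dist mu (kernel_pow mu (glauber e mu) k x) mu <= 4^-1.
Proof.
move=> x0 ln kn; have [f f1 ->] := tv_dist_test k x0.
set c := f finset.set0.
have near I : `|f I - c| <= 2 * size_of I.
  have [->|[v vI]] := set_0Vmem I; first by rewrite subrr normr0 mulr_ge0.
  have s1 : 1 <= size_of I by rewrite ler1n card_gt0; apply/set0Pn; exists v.
  apply: (le_trans (ler_normB _ _)); have := f1 I; have := f1 finset.set0.
  by rewrite -/c; lra.
have up I : f I <= 2 * size_of I + c.
  by have := near I; rewrite ler_norml => /andP[_ ?]; lra.
have lo I : c - 2 * size_of I <= f I.
  by have := near I; rewrite ler_norml => /andP[? _]; lra.
have := iter_step_mono k up (occupied x); rewrite iter_step_affine => U.
have := @le_mean finset.setT _ _ (fun I _ => lo I).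
rewrite meanB mean_const meanZ => L.
have S1 := iter_step_size k (occupied x).
have S2 : (1 - #|V|%:R^-1) ^+ k * size_of (occupied x) <= (1 - #|V|%:R^-1) ^+ k * #|V|%:R.
  rewrite ler_wpM2l ?ler_nat ?max_card // exprn_ge0 // subr_ge0 invf_le1 // ler1n //.
have S3 := mean_size; lra.
Qed.

Lemma partition_le S : partition S <= (1 + lam) ^+ #|S|.
Proof.
have [m] := ubnP #|S|; elim: m S => // m IH S Sm.
have [->|[v vS]] := set_0Vmem S; first by rewrite partition_set0 finset.cards0 expr0.
have cS : #|S| = #|cond0 S v|.+1 by rewrite (cardsD1 v S) vS.
rewrite (partition_split vS) cS exprS mulrDl mul1r.
have H : partition (cond0 S v) <= (1 + lam) ^+ #|cond0 S v| by apply: IH; rewrite -ltnS -cS.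
rewrite lerD // ler_wpM2l ?(ltW lam_gt0) //; apply: le_trans H.
by apply: wsum_sub => //; exact: cond1_cond0.
Qed.

(** Each of the [n] vertices costs at most a factor [1 + lam <= 10] in the
    partition function and a factor [1 / lam <= 16 * n] in the weight. *)
Lemma mu_lower x : lam <= 9 -> 16^-1 <= lam * #|V|%:R -> mu x != 0 ->
  expR (- (160 * #|V|%:R ^+ 2)) <= mu x.
Proof.
move=> l9 ln; set n := #|V|%:R => x0.
have n1 : 1 <= n by rewrite ler1n.
have a0 : 0 < (160 * n)^-1 by rewrite invr_gt0 mulr_gt0.
have step1 : expR (- (160 * n ^+ 2)) <= (160 * n)^-1 ^+ #|V|.
  have -> : - (160 * n ^+ 2) = #|V|%:R * - (160 * n) by rewrite -/n; ring.
  rewrite expRM_natl lerXn2r ?nnegrE ?expR_ge0 ?(ltW a0) //.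
  rewrite expRN lef_pV2 ?posrE ?expR_gt0 ?mulr_gt0 //.
  by have := expR_ge1Dx (160 * n); lra.
apply: (le_trans step1); rewrite muE.
have -> : weight (occupied x) = lam ^+ #|occupied x|.
  by move: x0; rewrite mu_neq0 weight_neq0 /weight => ->; rewrite mul1r.
have Z10 : partition finset.setT <= 10 ^+ #|V|.
  apply: (le_trans (partition_le _)); rewrite cardsT lerXn2r ?nnegrE //; last by lra.
  by rewrite ltW ?lam1_gt0.
rewrite ler_pdivlMr //; apply: (@le_trans _ _ ((160 * n)^-1 ^+ #|V| * 10 ^+ #|V|)).
  by rewrite ler_wpM2l // exprn_ge0 // ltW.
rewrite -exprMn; have -> : (160 * n)^-1 * 10 = (16 * n)^-1 by field; rewrite gt_eqF.
have b0 : 0 < 16 * n by rewrite mulr_gt0.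
have b1 : (16 * n)^-1 <= 1 by rewrite invf_le1 //; lra.
have bl : (16 * n)^-1 <= lam by rewrite -[leLHS]mul1r ler_pdivrMr //; rewrite -/n in ln; lra.
apply: (@le_trans _ _ ((16 * n)^-1 ^+ #|occupied x|)).
  by rewrite ler_wiXn2l ?invr_ge0 ?(ltW b0) // max_card.
by rewrite lerXn2r ?nnegrE ?invr_ge0 ?(ltW b0) ?(ltW lam_gt0).
Qed.

End PartitionFunction.

(** * Mixing time *)

Lemma mixing_time_le (R : realType) (X : finType) (mu : X -> R) (P : X -> X -> R)
    (k : nat) (c : R) :
  (forall x, mu x != 0 -> tv_dist mu (kernel_pow mu P k x) mu <= 4^-1) ->
  k%:R <= c -> (mixing_time mu P <= c%:E)%E.
Proof.
move=> H kc; apply: (@le_trans _ _ (k%:R)%:E); last by rewrite lee_fin.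
by apply: ereal_inf_lbound; exists k.
Qed.

Lemma small_time (R : realType) (n : nat) : (0 < n)%N ->
  (1 - n%:R^-1) ^+ (16 * n ^ 2) * n%:R <= 16^-1 :> R.
Proof.
move=> n0; have N0 : 0 < n%:R :> R by rewrite ltr0n.
have N1 : 1 <= n%:R :> R by rewrite ler1n.
have a01 : 0 <= (n%:R^-1 : R) <= 1 by rewrite invr_ge0 (ltW N0) invf_le1.
apply: (le_trans (ler_wpM2r (ltW N0) (exp_decay (16 * n ^ 2) a01))).
have -> : (16 * n ^ 2)%:R * n%:R^-1 = 16 * n%:R :> R.
  by rewrite natrM natrX; field; rewrite gt_eqF.
rewrite expRN mulrC ler_pdivrMr ?expR_gt0 // mulrC ler_pdivlMr //.
by have := expR_ge1Dx (16 * n%:R : R); lra.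
Qed.

Theorem theoremC2 (R : realType) (eps : R) (heps0 : 0 < eps) (heps1 : eps < 1) :
  exists C C' : R, 0 < C /\ 0 < C' /\
  forall (V : finType) (e : rel V),
    symmetric e -> irreflexive e -> (forall u v : V, connect e u v) ->
    let n := #|V| in
    let Delta := max_degree e in
    let rho := spectral_radius (adjacency R e) in
    (2 <= Delta)%N -> 2 <= rho ->
    forall lambda : R, 0 < lambda -> lambda <= (1 - eps) * lambda_c rho ->
    let mu := hard_core e lambda in
    (mixing_time mu (glauber e mu)
      <= (C * n%:R `^ (2 + C' * Num.sqrt (Delta%:R / rho)))%:E)%E.
Proof.
have c0 := infl_const_gt0 heps0 heps1.
exists 164, (1 + 20 * infl_const eps); split => //; split.
  by rewrite addr_gt0 // mulr_gt0.
move=> V e e_sym e_irr conn n Delta rho Delta2 rho2 lam lam0 lamc /=.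
set mu := hard_core e lam.
have n0 : (0 < #|V|)%N.
  rewrite lt0n; apply: contraTneq Delta2 => /eqP V0; rewrite -ltnNge /Delta /max_degree.
  rewrite big1 // => v; move: V0; rewrite -leqn0 leqNgt => /negP[].
  by apply/card_gt0P; exists v.
have N1 : 1 <= n%:R :> R by rewrite ler1n.
have N0 : 0 < n%:R :> R by rewrite ltr0n.
have [f [f0 fA rho_Delta]] := perron R e_sym n0 conn.
have rho0 : 0 < rho by apply: lt_le_trans rho2.
set s := Num.sqrt (Delta%:R / rho).
have s1 : 1 <= s.
  by rewrite -[leLHS]sqrtr1 ler_wsqrtr // ler_pdivlMr // mul1r.
have lam9 : lam <= 9.
  apply: (le_trans lamc); apply: le_trans (lambda_c_le9 rho2).
  by rewrite ler_piMl ?(ltW (lambda_c_gt0 rho2)) //; lra.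
have pow_le a : a <= 2 + (1 + 20 * infl_const eps) * s ->
    n%:R `^ a <= n%:R `^ (2 + (1 + 20 * infl_const eps) * s) :> R.
  by move=> ?; rewrite ler_powR.
have [small|large] := lerP (lam * #|V|%:R) 16^-1.
  apply: (@mixing_time_le _ _ _ _ (16 * n ^ 2)).
    by move=> x x0; apply: (tv_of_small_fugacity e_sym e_irr) => //; exact: small_time.
  rewrite natrM natrX; apply: (@le_trans _ _ (164 * n%:R `^ 2%:R)).
    by rewrite powR_mulrn ?ler0n // ler_wpM2r ?exprn_ge0 ?ler0n // ler_nat.
  rewrite ler_wpM2l // pow_le // lerDl mulr_ge0 //; last by lra.
  by rewrite addr_ge0 // mulr_ge0 // ltW.
set eta := infl_const eps * s.
have eta0 : 0 <= eta by rewrite mulr_ge0 ?(ltW c0) //; lra.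
set Phi := n%:R `^ (20 * eta) : R.
have Phi1 : 1 <= Phi.
  by rewrite -[leLHS](powRr0 n%:R) ler_powR // mulr_ge0.
have g0 w : 0 < f w `^ (1 - hexp rho) by rewrite powR_gt0.
have gap h : uvar e lam finset.setT h
    <= Phi * (lam / (1 + lam) * energy e lam finset.setT h).
  rewrite /Phi /n -finset.cardsT.
  apply: (poincare e_sym e_irr lam0 _ _ g0 eta0 lam9) => S v vS.
  exact: (total_influence e_sym e_irr lam0 rho2 heps0 heps1).
(* the logarithm of [4 / mu y], bounded using [4 <= expR 3], over the spectral gap *)
set x := (160 * n%:R ^+ 2 + 3) * (n%:R * Phi).
have nPhi : 1 <= n%:R * Phi by have := ler_pM ler01 ler01 N1 Phi1; rewrite mulr1.
have x0 : 0 <= x by rewrite mulr_ge0 ?(le_trans ler01 nPhi) // addr_ge0 // mulr_ge0 // sqr_ge0.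
apply: (@mixing_time_le _ _ _ _ (Num.truncn x).+1).
  move=> y y0; apply: (tv_of_contraction e_sym e_irr lam0 n0 Phi1) => //.
  have Hmu := mu_lower e_sym e_irr lam0 n0 lam9 (ltW large) y0.
  apply: (@le_trans _ _ (expR (- (160 * n%:R ^+ 2 + 3)))).
    rewrite ler_expR lerN2 ler_pdivlMr ?(lt_le_trans ltr01 nPhi) //.
    by rewrite ltW // truncnS_gt.
  rewrite opprD expRD ler_pM ?expR_ge0 // expRN lef_pV2 ?posrE ?expR_gt0 //.
  by have := expR_ge1Dx (3 : R); lra.
apply: (@le_trans _ _ (x + 1)).
  by rewrite -natr1 lerD2r truncn_le.
apply: (@le_trans _ _ (164 * (n%:R ^+ 2 * (n%:R * Phi)))).
  have : 1 <= n%:R ^+ 2 :> R by rewrite exprn_ege1.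
  by rewrite /x; set m := n%:R ^+ 2; move: nPhi; set q := n%:R * Phi; nra.
rewrite ler_wpM2l //.
have -> : n%:R ^+ 2 * (n%:R * Phi) = n%:R `^ (3 + 20 * eta).
  rewrite [in RHS]powRD; last by apply/implyP => _; exact: lt0r_neq0.
  by rewrite /Phi mulrA -exprSr powR_mulrn ?ler0n.
by apply: pow_le; rewrite /eta; lra.
Qed.
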